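(* Let $x\in\mathbb{R}^N$, $\eta_x>0$, and let $\phi:\mathbb{R}^N\to\mathbb{R}$ satisfy hypothesis (H) at $x$ with radius $\eta_x$. Then for every $\epsilon\in(0,\eta_x)$: $$\Big|\mathcal{A}_\epsilon^o\phi(x)-\phi(x)-\frac{1}{c_s(1-s)}\epsilon^{2s}\mathcal{L}_s[\phi](x)\Big|\le \frac{s}{1-s}C_x\epsilon^2+E_\epsilon,$$ where $E_\epsilon=0$ if $p_x=0$, and if $p_x\neq0$, $$E_\epsilon=\epsilon^{2s}\Big(4sC_x\frac{\eta_x^{2-2s}-\epsilon^{2-2s}}{1-s}A_\epsilon+\Big(\eta_x^{-2s}+\frac{2s}{2s-1}\eta_x^{1-2s}\Big)\omega_\phi(A_\epsilon)\Big).$$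
   Context: Fix $N\ge1$ and $s\in(\frac12,1)$. Let $C_s=\frac{4^s s\,\Gamma(\frac12+s)}{\pi^{1/2}\Gamma(1-s)}$ and $c_s=\frac{C_s}{s(1-s)}$. Let $\mu_s$ be the Borel measure on $(0,\infty)$ with $\mathrm{d}\mu_s(t)=C_s t^{-1-2s}\,\mathrm{d}t$ (so $\mu_s((\epsilon,\infty))=\frac{C_s}{2s\epsilon^{2s}}$), and write $\fint_\epsilon^\infty g\,\mathrm{d}\mu_s=\frac{1}{\mu_s((\epsilon,\infty))}\int_\epsilon^\infty g\,\mathrm{d}\mu_s$. For $\phi:\mathbb{R}^N\to\mathbb{R}$ and $x,y,\tilde y\in\mathbb{R}^N$ let $L_\phi(x,y,\tilde y)=\phi(x+y)+\phi(x-\tilde y)-2\phi(x)$. Define $$\mathcal{L}_s[\phi](x)=\sup_{|y|=1}\inf_{|\tilde y|=1}\int_0^\infty L_\phi(x,ty,t\tilde y)\,\mathrm{d}\mu_s(t),$$ where $\int_0^\infty$ means $\lim_{\delta\to0^+}\int_\delta^\infty$ (a value in $[-\infty,\infty]$); under the hypotheses this is a finite real number. Define the average $$\mathcal{A}_\epsilon^o\phi(x)=\frac12\Big(\sup_{|y|=1}\fint_\epsilon^\infty\phi(x+ty)\,\mathrm{d}\mu_s(t)+\inf_{|y|=1}\fint_\epsilon^\infty\phi(x+ty)\,\mathrm{d}\mu_s(t)\Big).$$ Hypothesis (H) at $x$ with radius $\eta_x>0$: $\phi:\mathbb{R}^N\to\mathbb{R}$ is bounded and Borel; (i) $\phi\in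 C^2(\bar B_{\eta_x}(x))$, and we set $p_x=\nabla\phi(x)$, $C_x=\frac12\|\nabla^2\phi\|_{L^\infty(B_{\eta_x}(x))}$; (ii) $\phi$ is bounded and uniformly continuous on $\mathbb{R}^N\setminus\bar B_{\eta_x}(x)$, with modulus $\omega_\phi(a)=\sup\{|\phi(z)-\phi(w)|: z,w\in\mathbb{R}^N\setminus\bar B_{\eta_x}(x),\ |z-w|\le a\}$. When $p_x\ne0$ and $0<\epsilon<\eta_x$ define $$\kappa_\epsilon=\sup\Big\{a\in[0,2]:\ a^2\le\frac{8\omega_\phi(a)}{|p_x|}\cdot\frac{\frac{2s-1}{2s}\eta_x^{-2s}+\eta_x^{1-2s}}{\epsilon^{1-2s}-\eta_x^{1-2s}}\Big\},\quad A_\epsilon=\max\Big\{\frac{16C_x}{|p_x|}\cdot\frac{2s-1}{1-s}\cdot\frac{\eta_x^{2-2s}-\epsilon^{2-2s}}{\epsilon^{1-2s}-\eta_x^{1-2s}},\ \kappa_\epsilon\Big\}.$$ *)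

(* Defs.v *)
From HB Require Import structures.
From mathcomp Require Import all_boot all_order all_algebra.
From mathcomp Require Import all_classical all_reals all_analysis.
Set Implicit Arguments. Unset Strict Implicit. Unset Printing Implicit Defensive.
Import Order.TTheory GRing.Theory Num.Theory.
Import numFieldNormedType.Exports.
Local Open Scope classical_set_scope.
Local Open Scope ring_scope.

Section Defs.
Variable R : realType.
Variable N : nat.
Local Notation V := 'rV[R]_N.
Local Notation mu := (@lebesgue_measure R).

Definition dotv (u v : V) : R := \sum_(i < N) u 0 i * v 0 i.
Definition enorm (v : V) : R := Num.sqrt (dotv v v).

Definition Gamma (z : R) : R :=
  fine (\int[mu]_(t in `]0, +oo[) (powR t (z - 1) * expR (- t))%:E).

Definition Cs (s : R) : R :=
  powR 4 s * s * Gamma (2^-1 + s) / (Num.sqrt pi * Gamma (1 - s)).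
Definition cs (s : R) : R := Cs s / (s * (1 - s)).

Definition mu_int (s d : R) (g : R -> R) : \bar R :=
  ((Cs s)%:E * \int[mu]_(t in `]d, +oo[) (g t * powR t (-1 - 2 * s))%:E)%E.

Definition mu_mass (s d : R) : R := fine (mu_int s d (fun=> 1)).

Definition mu_avg (s d : R) (g : R -> R) : R := fine (mu_int s d g) / mu_mass s d.

Definition Lphi (phi : V -> R) (x y yt : V) : R := phi (x + y) + phi (x - yt) - 2 * phi x.

(* int_0^oo := lim_{delta -> 0+} int_delta^oo *)
Definition Lint (s : R) (phi : V -> R) (x y yt : V) : \bar R :=
  lim (mu_int s d (fun t => Lphi phi x (t *: y) (t *: yt)) @[d --> 0^'+]).

Definition unit_sphere : set V := [set y | enorm y = 1].

Definition Ls (s : R) (phi : V -> R) (x : V) : \bar R :=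
  ereal_sup [set e | exists2 y, unit_sphere y &
     e = ereal_inf [set f | exists2 yt, unit_sphere yt & f = Lint s phi x y yt]].

Definition Aeps (s eps : R) (phi : V -> R) (x : V) : R :=
  2^-1 * (sup [set a | exists2 y, unit_sphere y & a = mu_avg s eps (fun t => phi (x + t *: y))]
        + inf [set a | exists2 y, unit_sphere y & a = mu_avg s eps (fun t => phi (x + t *: y))]).

Definition borel_fun (phi : V -> R) : Prop :=
  forall B : set R, measurable B -> <<s [set U : set V | open U] >> (phi @^-1` B).

Definition ucont_on (A : set V) (f : V -> R) : Prop :=
  forall e : R, 0 < e -> exists2 d : R, 0 < d &
    forall z w, A z -> A w -> enorm (z - w) < d -> `|f z - f w| < e.

Definition open_ball (x : V) (r : R) : set V := [set w | enorm (w - x) < r].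
Definition closed_ball (x : V) (r : R) : set V := [set w | enorm (w - x) <= r].
Definition outside_ball (x : V) (r : R) : set V := [set w | r < enorm (w - x)].

(* phi in C^2(closed ball B_eta(x)), with gradient G and Hessian Hs on the open ball:
   phi is twice differentiable in the open ball, and phi, its gradient and its Hessian
   extend continuously to the closed ball (phi continuous on the closed ball, gradient and
   Hessian uniformly continuous on the (bounded) open ball). *)
Definition C2_closed_ball (phi : V -> R) (x : V) (eta : R) (G : V -> V) (Hs : V -> 'M[R]_N) : Prop :=
  [/\ forall w, open_ball x eta w ->
        [/\ differentiable phi w, (forall h, 'D_h phi w = dotv (G w) h),
            differentiable G w & (forall h, 'D_h G w = h *m Hs w)],
      {within closed_ball x eta, continuous phi},
      (forall i, ucont_on (open_ball x eta) (fun w => G w 0 i)) &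
      (forall i j, ucont_on (open_ball x eta) (fun w => Hs w i j))].

Definition hypH (phi : V -> R) (x : V) (eta : R) (G : V -> V) (Hs : V -> 'M[R]_N) : Prop :=
  [/\ (exists M : R, forall z, `|phi z| <= M), borel_fun phi,
      C2_closed_ball phi x eta G Hs &
      ucont_on (outside_ball x eta) phi].

(* C_x = 1/2 || D^2 phi ||_{L^oo(B_eta(x))} (operator norm of the Hessian) *)
Definition Cx (x : V) (eta : R) (Hs : V -> 'M[R]_N) : R :=
  2^-1 * sup [set r | exists w z, [/\ open_ball x eta w, unit_sphere z &
                       r = `|(z *m Hs w *m z^T) 0 0|]].

Definition omega (phi : V -> R) (x : V) (eta a : R) : R :=
  sup [set r | exists z w, [/\ outside_ball x eta z, outside_ball x eta w,
                              enorm (z - w) <= a & r = `|phi z - phi w|]].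

Definition kappa (s : R) (phi : V -> R) (x : V) (eta : R) (p : V) (eps : R) : R :=
  sup [set a | [/\ 0 <= a, a <= 2 &
     a ^+ 2 <= 8 * omega phi x eta a / enorm p *
       ((((2 * s - 1) / (2 * s)) * powR eta (- 2 * s) + powR eta (1 - 2 * s))
          / (powR eps (1 - 2 * s) - powR eta (1 - 2 * s)))]].

Definition Aeps_err (s : R) (phi : V -> R) (x : V) (eta : R) (p : V) (Cx : R) (eps : R) : R :=
  Num.max (16 * Cx / enorm p * ((2 * s - 1) / (1 - s)) *
             ((powR eta (2 - 2 * s) - powR eps (2 - 2 * s))
               / (powR eps (1 - 2 * s) - powR eta (1 - 2 * s))))
          (kappa s phi x eta p eps).

Definition Eeps (s : R) (phi : V -> R) (x : V) (eta : R) (p : V) (Cx : R) (eps : R) : R :=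
  if p == 0 then 0 else
  let A := Aeps_err s phi x eta p Cx eps in
  powR eps (2 * s) *
    (4 * s * Cx * ((powR eta (2 - 2 * s) - powR eps (2 - 2 * s)) / (1 - s)) * A
     + (powR eta (- 2 * s) + (2 * s) / (2 * s - 1) * powR eta (1 - 2 * s)) * omega phi x eta A).

End Defs.

(* Main.v *)
(* Let F y be the integral of phi (x + t y) d mu_s over (eps, oo).  Up to the factor
   1 / (2 mu_s (eps, oo)), the claim compares sup F + inf F with the limit as delta -> 0 of the
   integrals of L_phi over (delta, oo).  By Taylor's formula the part of such an integral
   near 0 is of order C_x eps^(2-2s) when the directions y, y~ satisfy p.(y - y~) = 0, while
   it diverges to +oo or -oo with the sign of p.(y - y~) otherwise.  Hence, for p = 0, all
   the values in the sup-inf are finite and may be compared one by one; for p <> 0 the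
   sup-inf is attained at y = y~ = e := p/|p|.  In the second case it remains to bound
   sup F - F e and F (-e) - inf F.  These have the same sign, so in the sum
   sup F + inf F - F e - F (-e) they partly cancel and only the larger one counts.  For a unit
   vector y at distance a of e, F y - F e is at most the sum of a negative term of order
   |p| a^2, a term of order C_x a from the ball, and one of order omega(a) from its exterior;
   this sum is nonpositive unless a <= A_eps.  In dimension 1 the exterior is disconnected, but then
   the unit sphere is {e, -e} and the difference vanishes. *)

Require Import Defs.
From HB Require Import structures.
From mathcomp Require Import all_boot all_order all_algebra.
From mathcomp Require Import all_classical all_reals all_analysis.
From mathcomp Require Import measurable_realfun ring lra.
Set Implicit Arguments. Unset Strict Implicit. Unset Printing Implicit Defensive.
Import Order.TTheory GRing.Theory Num.Theory.
Import numFieldNormedType.Exports.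
Local Open Scope classical_set_scope.
Local Open Scope ring_scope.

(** * Integrals of powers and the constant C_s *)

Section PowerIntegrals.
Context {R : realType}.
Implicit Types a b q t : R.
Notation mu := (@lebesgue_measure R).

Lemma is_derive_powR_div q t : q != 0 -> 0 < t ->
  is_derive t 1 (fun t => t `^ q / q) (t `^ (q - 1)).
Proof.
move=> q0 t0; have H := is_derive1_powR q t0.
have H' := @is_deriveZ _ _ _ _ q^-1 _ _ _ H.
rewrite [X in is_derive _ _ X _](_ : _ = q^-1 \*: (fun u => u `^ q)); last first.
  by apply/funext => u /=; rewrite mulrC.
by apply: is_derive_eq; rewrite /GRing.scale/= mulrA mulVf// mul1r.
Qed.

Lemma is_derive1_continuous (f : R -> R) t df :
  is_derive t 1 f df -> f x @[x --> t] --> f t.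
Proof.
move=> H; apply: (@differentiable_continuous _ _ _ t f); apply/derivable1_diffP.
exact: ex_derive.
Qed.

Lemma continuous_powR_gt0 q t : 0 < t -> {for t, continuous (fun u : R => u `^ q)}.
Proof.
by move=> t0; apply: is_derive1_continuous; exact: is_derive1_powR.
Qed.

Lemma integral_powR q a b : q != 0 -> 0 < a -> a < b ->
  (\int[mu]_(t in `]a, b[) (t `^ (q - 1))%:E = ((b `^ q - a `^ q) / q)%:E)%E.
Proof.
move=> q0 a0 ab.
rewrite -(@integral_itv_bndoo R a b _ true false); last first.
  apply/measurable_EFinP/measurable_funTS; exact: measurable_powR.
rewrite (@continuous_FTC2 _ _ (fun t => t `^ q / q))//.
- by rewrite -EFinB mulrBl.
- apply: continuous_in_subspaceT => t /[!inE]/= /[!in_itv]/= /andP[at' _].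
  exact: continuous_powR_gt0 (lt_le_trans a0 at').
- split.
  + move=> t /[!in_itv]/= /andP[at' _].
    by apply: ex_derive; apply: is_derive_powR_div => //; exact: lt_trans at'.
  + apply: cvg_at_right_filter; exact: is_derive1_continuous (is_derive_powR_div q0 a0).
  + apply: cvg_at_left_filter; exact: is_derive1_continuous (is_derive_powR_div q0 (lt_trans a0 ab)).
- move=> t /[!in_itv]/= /andP[at' _]; rewrite derive1E.
  have := @is_derive_powR_div q t q0 (lt_trans a0 at').
  by move=> H; exact: derive_val.
Qed.

Lemma powR_cvgy0 q : q < 0 -> t `^ q @[t --> +oo%R] --> (0 : R).
Proof.
move=> q0; have -> : q = - (- q) by rewrite opprK.
under eq_fun do rewrite powRN.
apply: (@gtr0_cvgV0 R R (pinfty_nbhs R) _ (fun t => t `^ (- q)) _).2.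
  by near=> t; apply: powR_gt0; near: t; exact: nbhs_pinfty_gt.
apply/cvgryPge => A; near=> t.
have t0 : 0 < t by near: t; exact: nbhs_pinfty_gt.
have A0 : 0 < Num.max A 1 by rewrite lt_max ltr01 orbT.
apply: (@le_trans _ _ (Num.max A 1)); first by rewrite le_max lexx.
(* The threshold for t is the power [(- q)^-1] of max A 1; the maximum with 1 keeps the base
   positive. *)
have -> : Num.max A 1 = (Num.max A 1 `^ (- q)^-1) `^ (- q).
  by rewrite -powRrM mulVf ?powRr1// ?ltW// oppr_eq0 lt_eqF.
apply: ge0_ler_powR; rewrite ?nnegrE ?powR_ge0//.
by rewrite oppr_ge0 ltW.
Unshelve. all: by end_near. Qed.

Lemma integral_powRy q a : q < 0 -> 0 < a ->
  (\int[mu]_(t in `]a, +oo[) (t `^ (q - 1))%:E = (- (a `^ q / q))%:E)%E.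
Proof.
move=> q0 a0; have qn0 : q != 0 by rewrite lt_eqF.
rewrite integral_itv_obnd_cbnd; last first.
  apply/measurable_EFinP/measurable_funTS; exact: measurable_powR.
rewrite (@ge0_continuous_FTC2y R _ (fun t => t `^ q / q) a 0)//.
- by rewrite sub0e EFinN.
- by move=> t _; exact: powR_ge0.
- apply: continuous_in_subspaceT => t /[!inE]/= /[!in_itv]/= /andP[at' _].
  exact: continuous_powR_gt0 (lt_le_trans a0 at').
- by rewrite -[X in _ --> X](mul0r q^-1); apply: cvgMr_tmp; exact: powR_cvgy0.
- move=> t at'; apply: ex_derive; apply: is_derive_powR_div => //; exact: lt_trans at'.
- apply: cvg_at_right_filter; exact: is_derive1_continuous (is_derive_powR_div qn0 a0).
- move=> t /[!in_itv]/= /andP[at' _]; rewrite derive1E.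
  have := @is_derive_powR_div q t qn0 (lt_trans a0 at').
  by move=> H; exact: derive_val.
Qed.

(** The integrand may be singular at 0, so the interval is exhausted from the right. The truncated
    integrals are at most b^q / q, and monotone convergence passes this bound to the limit. *)
Lemma integral_powR0_lty q b : 0 < q -> 0 < b ->
  (\int[mu]_(t in `]0%R, b[) (t `^ (q - 1))%:E < +oo)%E.
Proof.
move=> q0 b0; have qn0 : q != 0 by rewrite gt_eqF.
(* Dividing by n + 2 keeps the left end strictly below b even for n = 0. *)
pose F n := `]b / n.+2%:R, b[%classic : set R.
have -> : `](0 : R), b[%classic = \bigcup_n F n.
  apply/seteqP; split => t; rewrite /F/= in_itv/=.
    move=> /andP[t0 tb].
    exists (Num.trunc (b / t)) => //=; rewrite in_itv/= tb andbT.
    rewrite ltr_pdivrMr//; rewrite mulrC -ltr_pdivrMr//.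
    apply: lt_le_trans (truncnS_gt (b / t)) _; by rewrite ler_nat.
  move=> [n _ /=]; rewrite in_itv/= => /andP[h ->]; rewrite andbT.
  by apply: lt_trans h; rewrite divr_gt0.
have Fb n : b / n.+2%:R < b by rewrite ltr_pdivrMr// ltr_pMr// ltr1n.
have cv : (\int[mu]_(t in F n) (t `^ (q - 1))%:E)%E @[n --> \oo] -->
    (\int[mu]_(t in \bigcup_n F n) (t `^ (q - 1))%:E)%E.
  apply: ge0_nondecreasing_set_cvg_integral.
  - move=> n m nm; rewrite /F; apply/subsetPset => t /=; rewrite !in_itv/= => /andP[h ->].
    rewrite andbT; apply: le_lt_trans h; rewrite ler_pM2l// lef_pV2 ?posrE//.
    by rewrite ler_nat.
  - by move=> n; exact: measurable_itv.
  - by move=> n; apply/measurable_EFinP/measurable_funTS; exact: measurable_powR.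
  - by move=> n t _; rewrite lee_fin powR_ge0.
apply: (@le_lt_trans _ _ (b `^ q / q)%:E); last exact: ltry.
rewrite -(cvg_lim (@ereal_hausdorff R) cv); apply: lime_le; first by apply/cvg_ex; eexists; exact: cv.
apply: nearW => n; rewrite /F integral_powR// ?divr_gt0// lee_fin.
rewrite ler_pM2r ?invr_gt0//; by rewrite lerBlDr lerDl powR_ge0.
Qed.

End PowerIntegrals.

(** * Positivity of the Gamma function and of C_s *)

Section GammaPos.
Context {R : realType}.
Implicit Types z t s : R.
Notation mu := (@lebesgue_measure R).

(** One term of the exponential series bounds e^t from below by t^(n+1) / (n+1)!. This gives
    arbitrary polynomial decay of the Gamma integrand at infinity. *)
Lemma expRN_le_powRN t (n : nat) : 0 < t ->
  expR (- t) <= n.+1`!%:R * t `^ (- n.+1%:R).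
Proof.
move=> t0; rewrite expRN powRN powR_mulrn; last exact: ltW.
have f0 : 0 < n.+1`!%:R :> R by rewrite ltr0n fact_gt0.
have h := expR_ge1Dxn n (ltW t0).
have -> : n.+1`!%:R * (t ^+ n.+1)^-1 = (t ^+ n.+1 / n.+1`!%:R)^-1.
  by rewrite invfM invrK mulrC.
rewrite lef_pV2 ?posrE ?expR_gt0 ?divr_gt0 ?exprn_gt0//.
by apply: le_trans h; rewrite lerDr.
Qed.

(** The integral is split at 1: below 1 the exponential is at most 1 and t^(z-1) is integrable,
    above 1 the exponential beats every power. *)
Lemma Gamma_lty z : 0 < z ->
  (\int[mu]_(t in `]0%R, +oo[) (powR t (z - 1) * expR (- t))%:E < +oo)%E.
Proof.
move=> z0; set f := fun t => powR t (z - 1) * expR (- t).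
have mf (D : set R) : measurable_fun D (EFin \o f).
  apply/measurable_EFinP/measurable_funTS/measurable_funM.
    exact: measurable_powR.
  by apply: measurableT_comp => //; exact: measurable_funN.
have f0 t : (0%:E <= (f t)%:E)%E by rewrite lee_fin mulr_ge0 ?powR_ge0 ?expR_ge0.
have -> : `]0%R, +oo[%classic = `]0%R, 1%R[%classic `|` `[1%R, +oo[%classic :> set R.
  by rewrite -itv_bndbnd_setU ?bnd_simp ?ltr01.
rewrite ge0_integral_setU//=; last 3 first.
  exact: mf.
  by move=> t _; exact: f0.
  by apply/disj_setPS => t /= []; rewrite !in_itv/= => /andP[_ t1]; rewrite leNgt t1.
apply: lte_add_pinfty.
  apply: le_lt_trans (integral_powR0_lty z0 ltr01).
  apply: ge0_le_integral => //=.
  - by move=> t _; exact: f0.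
  - exact: mf.
  - by apply/measurable_EFinP/measurable_funTS; exact: measurable_powR.
  move=> t; rewrite in_itv/= => /andP[t0 _].
  rewrite lee_fin /f ler_piMr ?powR_ge0//.
  by rewrite expR_le1 oppr_le0 ltW.
(* This n makes z - (n + 1) negative, so the dominating power is integrable at infinity. *)
pose n := (Num.trunc z).+1.
rewrite -integral_itv_obnd_cbnd//.
have q0 : (z - n.+1%:R : R) < 0.
  rewrite subr_lt0; apply: (lt_le_trans (truncnS_gt z)); by rewrite ler_nat.
apply: (@le_lt_trans _ _ (\int[mu]_(t in `]1%R, +oo[) ((n.+1`!%:R)%:E * (t `^ ((z - n.+1%:R) - 1))%:E))%E).
  apply: ge0_le_integral => //=.
  - by move=> t _; exact: f0.
  - exact: mf.
  - apply: measurable_funeM; apply/measurable_EFinP/measurable_funTS; exact: measurable_powR.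
  move=> t; rewrite in_itv/= andbT => t1.
  have t0 : 0 < t by apply: lt_trans t1.
  rewrite -EFinM lee_fin /f.
  have -> : z - n.+1%:R - 1 = (z - 1) + (- n.+1%:R) by ring.
  rewrite (@powRD _ t (z - 1)); last by apply/implyP => _; rewrite gt_eqF.
  rewrite mulrCA ler_wpM2l ?powR_ge0//; exact: expRN_le_powRN.
rewrite ge0_integralZl//=.
- by rewrite integral_powRy// -EFinM ltry.
- by apply/measurable_EFinP/measurable_funTS; exact: measurable_powR.
- by move=> t _; rewrite lee_fin powR_ge0.
Qed.

(** As [fine] sends +oo to 0, finiteness is needed as well as positivity. The latter is seen on ]1,
    2[, where t^(z-1) >= 1/t >= 1/2 and the exponential is at least e^(-2). *)
Lemma Gamma_gt0 z : 0 < z -> 0 < Gamma z.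
Proof.
move=> z0; rewrite /Gamma; apply: fine_gt0; apply/andP; split; last exact: Gamma_lty.
apply: (@lt_le_trans _ _ (\int[mu]_(t in `]1%R, 2%R[) (2^-1 * expR (- 2))%:E)%E).
  rewrite integral_cst//= lebesgue_measure_itv/= lte_fin ltr1n.
  by rewrite -EFinB -EFinM lte_fin !mulr_gt0// ?expR_gt0//; lra.
have mf (D : set R) : measurable_fun D (EFin \o (fun t => powR t (z - 1) * expR (- t))).
  apply/measurable_EFinP/measurable_funTS/measurable_funM.
    exact: measurable_powR.
  by apply: measurableT_comp => //; exact: measurable_funN.
apply: (@le_trans _ _ (\int[mu]_(t in `]1%R, 2%R[) (powR t (z - 1) * expR (- t))%:E)%E).
  apply: ge0_le_integral => //=.
  - exact: mf.
  move=> t; rewrite in_itv/= => /andP[t1 t2].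
  rewrite lee_fin ler_pM ?expR_ge0//; last by rewrite ler_expR lerN2 ltW.
  apply: (@le_trans _ _ (t `^ (-1))).
    rewrite powR_inv1; last by rewrite ltW// (lt_trans _ t1).
    by rewrite lef_pV2 ?posrE ?ltW// (lt_trans _ t1).
  by apply: ler_powR; [exact: ltW|lra].
apply: ge0_subset_integral => //=.
- exact: mf.
- by move=> t _; rewrite lee_fin mulr_ge0 ?powR_ge0 ?expR_ge0.
- move=> t /=; rewrite !in_itv/= => /andP[t1 _]; by rewrite (lt_trans _ t1).
Qed.

Lemma Cs_gt0 s : 0 < s -> s < 1 -> 0 < Cs s.
Proof.
move=> s0 s1; rewrite /Cs divr_gt0// !mulr_gt0 ?powR_gt0 ?Gamma_gt0 ?sqrtr_gt0 ?pi_gt0//.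
  by rewrite addr_gt0.
by rewrite subr_gt0.
Qed.
End GammaPos.

(** * Integrals against the singular weight *)

Lemma integrable_lin d (T : measurableType d) (R : realType)
    (mu : {measure set T -> \bar R}) (D : set T) (k1 k2 : R) (f g : T -> R) :
  measurable D ->
  mu.-integrable D (EFin \o f) -> mu.-integrable D (EFin \o g) ->
  mu.-integrable D (EFin \o (fun t => k1 * f t + k2 * g t)).
Proof.
move=> mD fi gi.
have h := integrableD mD (integrableZl mD k1 fi) (integrableZl mD k2 gi).
by apply: eq_integrable h => // t _; rewrite /= EFinD !EFinM.
Qed.

Lemma integrable_scale d (T : measurableType d) (R : realType)
    (mu : {measure set T -> \bar R}) (D : set T) (k : R) (f : T -> R) :
  measurable D ->
  mu.-integrable D (EFin \o f) -> mu.-integrable D (EFin \o (fun t => k * f t)).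
Proof.
move=> mD fi; have h := integrableZl mD k fi.
by apply: eq_integrable h => // t _; rewrite /= !EFinM.
Qed.

Section WeightedIntegrals.
Context {R : realType}.
Notation mu := (@lebesgue_measure R).
Variable s : R.
Hypotheses (hs1 : 2^-1 < s) (hs2 : s < 1).
Implicit Types (f g : R -> R) (a b c d M : R).

(** Real-valued and without the factor C_s; [mu_int_wint] converts [mu_int] to it for bounded
    measurable integrands. *)
Definition wint (D : set R) f : R :=
  (\int[mu]_(t in D) (f t * powR t (-1 - 2 * s)))%R.

Definition bounded_meas f :=
  measurable_fun [set: R] f /\ exists M, forall t, `|f t| <= M.

Lemma bounded_meas_cst c : bounded_meas (fun=> c).
Proof. by split; [exact: measurable_cst|exists `|c|]. Qed.

Lemma bounded_measD f g : bounded_meas f -> bounded_meas g ->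
  bounded_meas (fun t => f t + g t).
Proof.
move=> [mf [M fM]] [mg [M' gM]]; split; first exact: measurable_funD.
by exists (M + M') => t; rewrite (le_trans (ler_normD _ _))// lerD.
Qed.

Lemma bounded_measZ c f : bounded_meas f -> bounded_meas (fun t => c * f t).
Proof.
move=> [mf [M fM]]; split; first exact: measurable_funM.
by exists (`|c| * M) => t; rewrite normrM ler_wpM2l.
Qed.

Lemma measurable_weight (D : set R) f : measurable_fun [set: R] f ->
  measurable_fun D (EFin \o (fun t => f t * powR t (-1 - 2 * s))).
Proof.
by move=> mf; apply/measurable_EFinP/measurable_funTS/measurable_funM.
Qed.

Lemma weightE : -1 - 2 * s = (- 2 * s) - 1.
Proof. ring. Qed.

Lemma weight_ltm : - 2 * s < 0.
Proof. by rewrite mulNr oppr_lt0 mulr_gt0// (lt_trans _ hs1). Qed.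

Lemma twos_gt1 : 1 < 2 * s.
Proof. by rewrite mulrC -ltr_pdivrMr// mul1r. Qed.

(** Away from 0 the integrand is dominated by a multiple of t^(-1-2s), which is integrable at
    infinity. *)
Lemma integrable_weight d f : 0 < d -> bounded_meas f ->
  mu.-integrable `]d, +oo[ (EFin \o (fun t => f t * powR t (-1 - 2 * s))).
Proof.
move=> d0 [mf [M fM]]; apply/integrableP; split; first exact: measurable_weight.
apply: (@le_lt_trans _ _ (\int[mu]_(t in `]d, +oo[) (M%:E * (t `^ ((- 2 * s) - 1))%:E))%E).
  apply: ge0_le_integral => //=.
  - apply/measurable_EFinP; apply: measurableT_comp => //.
    by apply/measurable_EFinP; exact: measurable_weight.
  - apply: measurable_funeM; apply/measurable_EFinP/measurable_funTS; exact: measurable_powR.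
  - move=> t _; rewrite -EFinM lee_fin normrM -weightE [X in _ * X]ger0_norm ?powR_ge0//.
    by rewrite ler_wpM2r ?powR_ge0.
rewrite ge0_integralZl//=.
- by rewrite integral_powRy ?weight_ltm// -EFinM ltry.
- by apply/measurable_EFinP/measurable_funTS; exact: measurable_powR.
- by move=> t _; rewrite lee_fin powR_ge0.
- by rewrite lee_fin (le_trans _ (fM 0)).
Qed.

Lemma integrable_weight_itv a b f : 0 < a -> bounded_meas f ->
  mu.-integrable `]a, b[ (EFin \o (fun t => f t * powR t (-1 - 2 * s))).
Proof.
move=> a0 bf; apply: integrableS (integrable_weight a0 bf) => //.
by move=> t /=; rewrite !in_itv/= => /andP[-> _].
Qed.

Lemma mu_int_wint d f : 0 < d -> bounded_meas f ->
  mu_int s d f = (Cs s * wint `]d, +oo[ f)%:E.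
Proof.
move=> d0 bf; rewrite /mu_int [in RHS]EFinM /wint /Rintegral fineK//.
exact: (integrable_fin_num _ (integrable_weight d0 bf)).
Qed.

Lemma wintD d f g : 0 < d -> bounded_meas f -> bounded_meas g ->
  wint `]d, +oo[ (fun t => f t + g t) = wint `]d, +oo[ f + wint `]d, +oo[ g.
Proof.
move=> d0 bf bg; rewrite /wint; under eq_Rintegral do rewrite mulrDl.
by rewrite RintegralD//; exact: integrable_weight.
Qed.

Lemma wintZ d c f : 0 < d -> bounded_meas f ->
  wint `]d, +oo[ (fun t => c * f t) = c * wint `]d, +oo[ f.
Proof.
move=> d0 bf; rewrite /wint; under eq_Rintegral do rewrite -mulrA.
by rewrite RintegralZl//; exact: integrable_weight.
Qed.

Lemma wint1 d : 0 < d -> wint `]d, +oo[ (fun=> 1) = d `^ (- 2 * s) / (2 * s).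
Proof.
move=> d0; rewrite /wint /Rintegral; under eq_integral do rewrite mul1r weightE.
rewrite integral_powRy ?weight_ltm//=.
by rewrite -mulrN; congr (_ * _); rewrite -invrN mulNr opprK.
Qed.

Lemma wint_split a b f : 0 < a -> a < b -> bounded_meas f ->
  wint `]a, +oo[ f = wint `]a, b[ f + wint `]b, +oo[ f.
Proof.
move=> a0 ab bf; have b0 := lt_trans a0 ab.
rewrite /wint [in RHS](@Rintegral_itv_obnd_cbnd _ b); last exact: integrable_weight.
rewrite -Rintegral_setU//=.
- congr (Rintegral _ _ _); apply: (@itv_bndbnd_setU _ _ (BRight a) (BLeft b) +oo%O) => //.
- apply: integrableS (integrable_weight a0 bf) => //.
    exact: measurableU.
  move=> t /=; rewrite !in_itv/= !andbT => -[/andP[]//|]; exact: lt_le_trans.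
- apply/disj_setPS => t /= []; rewrite !in_itv/= => /andP[_ tb] /andP[bt _].
  by rewrite leNgt tb in bt.
Qed.

Lemma powR_mul_weight t q : 0 < t -> t `^ q * t `^ (-1 - 2 * s) = t `^ ((q - 2 * s) - 1).
Proof.
move=> t0; rewrite -powRD; last by apply/implyP => _; rewrite gt_eqF.
by congr (_ `^ _); ring.
Qed.

(** The exponents 1 - 2s < 0 < 2 - 2s have opposite signs, so the differences are written to be
    nonnegative in both terms. As a tends to 0 the first one blows up and the second stays
    bounded. *)
Lemma wint_itv_le a b f k1 k2 : 0 < a -> a < b -> bounded_meas f ->
  (forall t, a < t -> t < b -> f t <= k1 * t + k2 * t ^+ 2) ->
  wint `]a, b[ f <= k1 * ((a `^ (1 - 2 * s) - b `^ (1 - 2 * s)) / (2 * s - 1))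
                  + k2 * ((b `^ (2 - 2 * s) - a `^ (2 - 2 * s)) / (2 * (1 - s))).
Proof.
move=> a0 ab bf H.
have int_pow q : q != 0 -> mu.-integrable `]a, b[ (EFin \o (fun t => t `^ (q - 1))).
  move=> q0; apply/integrableP; split.
    by apply/measurable_EFinP/measurable_funTS; exact: measurable_powR.
  under eq_integral => t _ do rewrite /= ger0_norm ?powR_ge0//.
  by rewrite integral_powR// ltry.
have q1 : 1 - 2 * s != 0 by rewrite lt_eqF// subr_lt0 twos_gt1.
have q2 : 2 - 2 * s != 0 by rewrite gt_eqF// subr_gt0 gtr_pMr.
have i1 := int_pow _ q1; have i2 := int_pow _ q2.
have j1 : mu.-integrable `]a, b[ (EFin \o (fun t => k1 * t `^ ((1 - 2 * s) - 1))).
  exact: integrable_scale.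
have j2 : mu.-integrable `]a, b[ (EFin \o (fun t => k2 * t `^ ((2 - 2 * s) - 1))).
  exact: integrable_scale.
apply: (@le_trans _ _ (\int[mu]_(t in `]a, b[)
   (k1 * t `^ ((1 - 2 * s) - 1) + k2 * t `^ ((2 - 2 * s) - 1)))%R).
  apply: le_Rintegral => //; first exact: integrable_weight_itv.
    exact: integrable_lin.
  move=> t /=; rewrite in_itv/= => /andP[at' tb].
  have t0 := lt_trans a0 at'; have t0' := ltW t0.
  rewrite -!powR_mul_weight// powRr1// (@powR_mulrn _ t 2)//.
  rewrite !mulrA -mulrDl ler_wpM2r ?powR_ge0//. rewrite -mulrA; exact: H.
rewrite RintegralD// !RintegralZl//.
rewrite /Rintegral !integral_powR//=.
suff -> : (b `^ (1 - 2 * s) - a `^ (1 - 2 * s)) / (1 - 2 * s) =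
  (a `^ (1 - 2 * s) - b `^ (1 - 2 * s)) / (2 * s - 1).
  by rewrite (_ : 2 * (1 - s) = 2 - 2 * s)//; ring.
by rewrite -(opprB (a `^ _)) -(opprB (2 * s)) mulNr invrN mulrN opprK.
Qed.

(** The linear growth 1 + t is that of the number of steps in a chain along an arc of radius t; it
    is integrable at infinity because s > 1/2. *)
Lemma wint_itvy_le d f c : 0 < d -> bounded_meas f -> 0 <= c ->
  (forall t, d < t -> f t <= c * (1 + t)) ->
  wint `]d, +oo[ f <= c * (d `^ (- 2 * s) / (2 * s) + d `^ (1 - 2 * s) / (2 * s - 1)).
Proof.
move=> d0 bf c0 H.
have q1 : 1 - 2 * s < 0 by rewrite subr_lt0 twos_gt1.
have int_pow q : q < 0 -> mu.-integrable `]d, +oo[ (EFin \o (fun t => t `^ (q - 1))).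
  move=> q0; apply/integrableP; split.
    by apply/measurable_EFinP/measurable_funTS; exact: measurable_powR.
  under eq_integral => t _ do rewrite /= ger0_norm ?powR_ge0//.
  by rewrite integral_powRy// ltry.
have i0 := int_pow _ weight_ltm; have i1 := int_pow _ q1.
have i01 : mu.-integrable `]d, +oo[ (EFin \o (fun t => t `^ ((- 2 * s) - 1) + t `^ ((1 - 2 * s) - 1))).
  rewrite [X in _ \o X](_ : _ =
    (fun t => 1 * t `^ ((- 2 * s) - 1) + 1 * t `^ ((1 - 2 * s) - 1))).
    exact: integrable_lin.
  by apply/funext => t; rewrite !mul1r.
apply: (@le_trans _ _ (\int[mu]_(t in `]d, +oo[)
   (c * (t `^ ((- 2 * s) - 1) + t `^ ((1 - 2 * s) - 1))))%R).
  apply: le_Rintegral => //; first exact: integrable_weight.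
    exact: integrable_scale.
  move=> t /=; rewrite in_itv/= andbT => dt.
  have t0 := lt_trans d0 dt.
  have -> : t `^ (- 2 * s - 1) + t `^ (1 - 2 * s - 1) = (1 + t) * t `^ (-1 - 2 * s).
    rewrite -powR_mul_weight// powRr1 ?(ltW t0)// weightE; ring.
  by rewrite mulrA ler_wpM2r ?powR_ge0//; exact: H.
rewrite RintegralZl// RintegralD// /Rintegral !integral_powRy ?weight_ltm//=.
rewrite ler_wpM2l// lerD//.
  by rewrite -mulrN -invrN mulNr opprK.
by rewrite -mulrN -invrN opprB.
Qed.

End WeightedIntegrals.

(** * Euclidean geometry and Taylor estimates *)

Section Euclid.
Context {R : realType} {N : nat}.
Local Notation V := 'rV[R]_N.
Implicit Types (u v w h : V) (k : R).

Lemma dotvC u v : dotv u v = dotv v u.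
Proof. by apply: eq_bigr => i _; rewrite mulrC. Qed.

Lemma dotvDl u v w : dotv (u + v) w = dotv u w + dotv v w.
Proof. by rewrite -big_split; apply: eq_bigr => i _; rewrite mxE mulrDl. Qed.

Lemma dotvZl k u v : dotv (k *: u) v = k * dotv u v.
Proof. by rewrite /dotv big_distrr; apply: eq_bigr => i _; rewrite mxE -mulrA. Qed.

Lemma dotvNl u v : dotv (- u) v = - dotv u v.
Proof. by rewrite -scaleN1r dotvZl mulN1r. Qed.

Lemma dotvDr u v w : dotv w (u + v) = dotv w u + dotv w v.
Proof. by rewrite dotvC dotvDl !(dotvC w). Qed.

Lemma dotvZr k u v : dotv u (k *: v) = k * dotv u v.
Proof. by rewrite dotvC dotvZl dotvC. Qed.

Lemma dotvNr u v : dotv u (- v) = - dotv u v.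
Proof. by rewrite dotvC dotvNl dotvC. Qed.

Definition dotvE := (dotvDl, dotvDr, dotvNl, dotvNr, dotvZl, dotvZr).

Lemma dotvv_ge0 u : 0 <= dotv u u.
Proof. by apply: sumr_ge0 => i _; rewrite -expr2 sqr_ge0. Qed.

Lemma dotvv_eq0 u : (dotv u u == 0) = (u == 0).
Proof.
apply/idP/eqP => [|->]; last first.
  by rewrite /dotv big1// => i _; rewrite mxE mul0r.
rewrite psumr_eq0; last by move=> i _; rewrite -expr2 sqr_ge0.
move=> /allP u0; apply/rowP => i; rewrite mxE.
by have := u0 i (mem_index_enum _); rewrite /= mulf_eq0 orbb => /eqP.
Qed.

Lemma enorm_ge0 u : 0 <= enorm u.
Proof. exact: sqrtr_ge0. Qed.

Lemma sqr_enorm u : enorm u ^+ 2 = dotv u u.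
Proof. by rewrite sqr_sqrtr// dotvv_ge0. Qed.

Lemma enorm_eq0 u : (enorm u == 0) = (u == 0).
Proof. by rewrite -dotvv_eq0 -sqr_enorm sqrf_eq0. Qed.

Lemma enorm_gt0 u : (0 < enorm u) = (u != 0).
Proof. by rewrite lt_neqAle enorm_ge0 andbT eq_sym enorm_eq0. Qed.

Lemma enorm0 : enorm (0 : V) = 0.
Proof. by apply/eqP; rewrite enorm_eq0. Qed.

Lemma enormZ k u : enorm (k *: u) = `|k| * enorm u.
Proof.
by rewrite /enorm dotvZl dotvZr mulrA -expr2 sqrtrM ?sqr_ge0// sqrtr_sqr.
Qed.

Lemma enormN u : enorm (- u) = enorm u.
Proof. by rewrite -scaleN1r enormZ normrN1 mul1r. Qed.

Lemma cauchy_schwarz u v : `|dotv u v| <= enorm u * enorm v.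
Proof.
rewrite -(@ler_pXn2r _ 2)// ?nnegrE ?normr_ge0 ?mulr_ge0 ?enorm_ge0//.
rewrite real_normK ?num_real// exprMn !sqr_enorm.
have [/eqP|v0] := eqVneq v 0.
  rewrite -dotvv_eq0 => /eqP h; move: (h) => /eqP; rewrite dotvv_eq0 => /eqP ->.
  by rewrite -(scale0r (0 : V)) !dotvZr !mul0r expr0n mulr0.
have c0 : 0 < dotv v v by rewrite lt_neqAle dotvv_ge0 andbT eq_sym dotvv_eq0.
(* This square expands to c (a c - b^2), with a = u.u, b = u.v and c = v.v > 0. *)
have := dotvv_ge0 (dotv v v *: u - dotv u v *: v).
rewrite !dotvE (dotvC v u).
set a := dotv u u; set b := dotv u v; set c := dotv v v => h.
have : 0 <= c * (a * c - b ^+ 2) by apply: le_trans h _; rewrite le_eqVlt; apply/orP; left; apply/eqP; ring.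
by rewrite pmulr_rge0// subr_ge0.
Qed.

Lemma enormD u v : enorm (u + v) <= enorm u + enorm v.
Proof.
rewrite -(@ler_pXn2r _ 2)// ?nnegrE ?addr_ge0 ?enorm_ge0//.
rewrite sqr_enorm !dotvE sqrrD !sqr_enorm (dotvC v u).
have := le_trans (ler_norm _) (cauchy_schwarz u v); lra.
Qed.

Lemma abs_coord_le u i : `|u 0 i| <= enorm u.
Proof.
rewrite -(@ler_pXn2r _ 2)// ?nnegrE ?normr_ge0 ?enorm_ge0//.
rewrite real_normK ?num_real// sqr_enorm /dotv (bigD1 i)//= -expr2 lerDl.
by apply: sumr_ge0 => j _; rewrite -expr2 sqr_ge0.
Qed.

Lemma open_ball_convex (x u h : V) (eta t : R) : 0 <= t -> t <= 1 ->
  open_ball x eta u -> open_ball x eta (u + h) -> open_ball x eta (u + t *: h).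
Proof.
move=> t0 t1 xu xuh; rewrite /open_ball/=.
have -> : u + t *: h - x = (1 - t) *: (u - x) + t *: (u + h - x).
  by apply/rowP => i; rewrite !mxE; ring.
apply: le_lt_trans (enormD _ _) _; rewrite !enormZ !ger0_norm ?subr_ge0//.
move: xu xuh; rewrite /open_ball/= => xu xuh.
(* Strictness comes from the term with factor t, so t = 0 is treated apart. *)
have [->|tn0] := eqVneq t 0; first by rewrite subr0 mul1r mul0r addr0.
have tp : 0 < t by rewrite lt_neqAle eq_sym tn0.
have -> : eta = (1 - t) * eta + t * eta by ring.
by rewrite ler_ltD// ?ltr_pM2l// ler_wpM2l ?subr_ge0// ltW.
Qed.

End Euclid.

Section Taylor.
Context {R : realType} {N : nat}.
Local Notation V := 'rV[R]_N.
Implicit Types (u v w h : V) (f : V -> R).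

(** The two difference quotients are the same function of the increment. *)
Lemma is_derive_line f u h (t : R) : derivable f (u + t *: h) h ->
  is_derive t 1 (fun r => f (u + r *: h)) ('D_h f (u + t *: h)).
Proof.
have E : (fun r : R => r^-1 *: (((fun r => f (u + r *: h)) \o shift t) (r *: 1) - f (u + t *: h)))
   = (fun r => r^-1 *: ((f \o shift (u + t *: h)) (r *: h) - f (u + t *: h))).
  apply/funext => r /=; congr (_ *: (f _ - _)).
  by rewrite [r *: 1]mulr1 scalerDl addrCA.
move=> df; split; first by rewrite /derivable E.
by rewrite /derive E.
Qed.

Section C2.
Variables (phi : V -> R) (G : V -> V) (Hs : V -> 'M[R]_N) (x : V) (eta M : R).
Hypothesis hd : forall w, open_ball x eta w ->
  [/\ differentiable phi w, (forall h, 'D_h phi w = dotv (G w) h),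
      differentiable G w & (forall h, 'D_h G w = h *m Hs w)].
Hypothesis hM : forall w z, open_ball x eta w ->
  `|(z *m Hs w *m z^T) 0 0| <= M * enorm z ^+ 2.

Lemma is_derive_grad_line u h (t : R) : open_ball x eta (u + t *: h) ->
  is_derive t 1 (fun r => dotv (G (u + r *: h)) h)
     ((h *m Hs (u + t *: h) *m h^T) 0 0).
Proof.
move=> /hd[_ _ dG DG].
have dGh : derivable G (u + t *: h) h by exact: diff_derivable.
have dc i : is_derive t 1 (fun r => G (u + r *: h) 0 i) ((h *m Hs (u + t *: h)) 0 i).
  apply: is_derive_eq.
    apply: (@is_derive_line (fun w => G w 0 i)).
    by move/derivable_mxP : dGh; apply.
  by rewrite -DG derive_mx// mxE.
have H : forall i, is_derive t 1 (h 0 i \*: (fun r => G (u + r *: h) 0 i))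
      (h 0 i *: ((h *m Hs (u + t *: h)) 0 i)).
  by move=> i; exact: is_deriveZ.
rewrite [X in is_derive _ _ X _](_ : _ =
   \sum_(i < N) (h 0 i \*: (fun r => G (u + r *: h) 0 i))); last first.
  apply/funext => r; rewrite /dotv fct_sumE; apply: eq_bigr => i _.
  by rewrite /= mulrC.
apply: is_derive_eq.
by rewrite [RHS]mxE; apply: eq_bigr => i _; rewrite [h^T _ _]mxE mulrC.
Qed.

(** The mean value theorem is used twice: it bounds the increment of the gradient along h by K t,
    and then shows that phi minus its quadratic majorant does not increase along the segment. *)
Lemma second_order_taylor_le u h : open_ball x eta u -> open_ball x eta (u + h) ->
  phi (u + h) - phi u - dotv (G u) h <= M / 2 * enorm h ^+ 2.
Proof.
move=> xu xuh; set K := M * enorm h ^+ 2.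
have inb t : 0 <= t -> t <= 1 -> open_ball x eta (u + t *: h).
  by move=> t0 t1; exact: open_ball_convex.
have dg (t : R) : 0 <= t -> t <= 1 ->
    is_derive t 1 (fun r => phi (u + r *: h)) (dotv (G (u + t *: h)) h).
  move=> t0 t1; have [dphi Dphi _ _] := hd (inb t t0 t1).
  by rewrite -Dphi; apply: is_derive_line; exact: diff_derivable.
have cont (f df : R -> R) (a : R) : 0 <= a -> a <= 1 ->
    (forall t : R, 0 <= t -> t <= 1 -> is_derive t 1 f (df t)) ->
    {within `[0, a], continuous f}.
  move=> a0 a1 H; apply: derivable_within_continuous => t; rewrite in_itv/= => /andP[t0 ta].
  by apply: ex_derive; apply: H => //; exact: le_trans a1.
have g'le (t : R) : 0 <= t -> t <= 1 -> dotv (G (u + t *: h)) h - dotv (G u) h <= K * t.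
  move=> t0 t1.
  have H (r : R) : 0 <= r -> r <= 1 -> is_derive r 1 (fun r => dotv (G (u + r *: h)) h)
     ((h *m Hs (u + r *: h) *m h^T) 0 0).
    by move=> r0 r1; apply: is_derive_grad_line; exact: inb.
  have [|c] := @MVT_segment _ _ (fun r => (h *m Hs (u + r *: h) *m h^T) 0 0) 0 t t0
      _ (cont _ _ t t0 t1 H).
    by move=> r; rewrite in_itv/= => /andP[r0 rt]; apply: H; rewrite ltW// (lt_le_trans rt).
  rewrite in_itv/= => /andP[c0 ct]; rewrite scale0r addr0 subr0 => ->.
  rewrite ler_wpM2r//; apply: le_trans (ler_norm _) _; apply: hM; apply: inb => //.
  exact: le_trans t1.
pose k := fun r : R => phi (u + r *: h) - dotv (G u) h * r - K / 2 * r ^+ 2.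
have dk (t : R) : 0 <= t -> t <= 1 ->
   is_derive t 1 k (dotv (G (u + t *: h)) h - dotv (G u) h - K * t).
  move=> t0 t1; have H := dg t t0 t1.
  pose g := fun r => phi (u + r *: h).
  rewrite [X in is_derive _ _ X _](_ : _ = g - (dotv (G u) h) \*: id - (K / 2) \*: (id ^+ 2)); last first.
    by apply/funext => r; rewrite /k.
  apply: is_derive_eq.
  by rewrite /GRing.scale/= !mulr1 expr1; congr (_ - _); field.
have [|c] := @MVT_segment _ _ (fun t => dotv (G (u + t *: h)) h - dotv (G u) h - K * t) 0 1 ler01
      _ (cont _ _ 1 ler01 (lexx _) dk).
  by move=> r; rewrite in_itv/= => /andP[r0 rt]; apply: dk; exact: ltW.
rewrite in_itv/= => /andP[c0 c1]; rewrite /k !scale1r !scale0r !addr0 => E.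
have := g'le c c0 c1; move: E; rewrite expr0n /= expr1n.
have -> : M / 2 * enorm h ^+ 2 = K / 2 by rewrite /K mulrAC.
by lra.
Qed.

End C2.
End Taylor.

Section TaylorConsequences.
Context {R : realType} {N : nat}.
Local Notation V := 'rV[R]_N.
Implicit Types (u v w h y e : V).

Section C2.
Variables (phi : V -> R) (G : V -> V) (Hs : V -> 'M[R]_N) (x : V) (eta M : R).
Hypothesis hd : forall w, open_ball x eta w ->
  [/\ differentiable phi w, (forall h, 'D_h phi w = dotv (G w) h),
      differentiable G w & (forall h, 'D_h G w = h *m Hs w)].
Hypothesis hM : forall w z, open_ball x eta w ->
  `|(z *m Hs w *m z^T) 0 0| <= M * enorm z ^+ 2.
Hypothesis M0 : 0 <= M.

(** The missing lower bound is the upper bound for - phi. *)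
Lemma second_order_taylor u h : open_ball x eta u -> open_ball x eta (u + h) ->
  `|phi (u + h) - phi u - dotv (G u) h| <= M / 2 * enorm h ^+ 2.
Proof.
move=> xu xuh; rewrite ler_norml; apply/andP; split; last exact: (second_order_taylor_le hd hM).
have := @second_order_taylor_le R N (fun w => - phi w) (fun w => - G w)
  (fun w => - Hs w) x eta M _ _ u h xu xuh.
rewrite dotvNl => H.
rewrite lerNl; apply: le_trans (H _ _).
- by rewrite le_eqVlt; apply/orP; left; apply/eqP; ring.
- move=> w /hd[dphi Dphi dG DG]; split.
  + exact: differentiableN.
  + by move=> k; rewrite deriveN ?Dphi ?dotvNl//; exact: diff_derivable.
  + exact: differentiableN.
  + by move=> k; rewrite deriveN ?DG ?mulmxN//; exact: diff_derivable.
- move=> w z /hM; by rewrite mulmxN mulNmx mxE normrN.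
Qed.

Lemma open_ball_shift h : enorm h < eta -> open_ball x eta (x + h).
Proof. by rewrite /open_ball/= addrAC subrr add0r. Qed.

(* Only the quadratic form of the Hessian is bounded by [M], so the mixed term is obtained by
   expanding phi at [x + z] towards [x + h] and towards [x]; this avoids the symmetry
   of the Hessian. *)
Lemma gradient_diff_le (z h : V) : enorm z < eta -> enorm h = enorm z ->
  dotv (G (x + z) - G x) h <= 3 * M * enorm z ^+ 2.
Proof.
move=> zeta hz.
have eta0 : 0 < eta by apply: le_lt_trans (enorm_ge0 z) zeta.
have bx : open_ball x eta (x + 0) by apply: open_ball_shift; rewrite enorm0.
have bz := open_ball_shift zeta.
have bh : open_ball x eta (x + h) by apply: open_ball_shift; rewrite hz.
have T1 := @second_order_taylor (x + z) (h - z) bz; rewrite -addrA subrKC in T1.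
have {}T1 := T1 bh.
have T2 := @second_order_taylor (x + z) (- z) bz; rewrite addrK enormN in T2.
rewrite addr0 in bx; have {}T2 := T2 bx.
have T3 := @second_order_taylor x h bx bh.
(* The expansion along h - z costs M/2 times 4 |z|^2, the two others M/2 times |z|^2 each, which
   makes 3 M |z|^2. *)
have hz2 : enorm (h - z) ^+ 2 <= (2 * enorm z) ^+ 2.
  rewrite ler_pXn2r// ?nnegrE ?mulr_ge0 ?enorm_ge0//.
  by apply: le_trans (enormD _ _) _; rewrite enormN hz mulr2n mulrDl mul1r.
have : M * enorm (h - z) ^+ 2 <= M * (2 * enorm z) ^+ 2 by rewrite ler_wpM2l.
rewrite exprMn; move: T1 T2 T3; rewrite !dotvE hz.
rewrite !ler_norml => /andP[T1 _] /andP[_ T2] /andP[_ T3].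
lra.
Qed.

(** Expanding at x + t e rather than at x puts a factor |y - e| in front of the error. Moving the
    gradient back to x costs 3 M, and the remainder costs M because |y - e| <= 2. *)
Lemma sphere_diff_le y e t : enorm y = 1 -> enorm e = 1 -> 0 < t -> t < eta ->
  phi (x + t *: y) - phi (x + t *: e) - t * dotv (G x) (y - e) <=
  4 * M * enorm (y - e) * t ^+ 2.
Proof.
move=> y1 e1 t0 teta; set a := enorm (y - e).
have tn (k : V) : enorm k = 1 -> enorm (t *: k) = t by move=> k1; rewrite enormZ k1 mulr1 gtr0_norm.
have [/eqP|a0] := eqVneq a 0.
  rewrite /a enorm_eq0 subr_eq0 => /eqP ->.
  by rewrite !subrr -(scale0r (0 : V)) dotvZr enormZ normr0 !(mul0r, mulr0) subrr.
have ap : 0 < a by rewrite lt_neqAle eq_sym a0 enorm_ge0.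
have a2 : a <= 2 by apply: le_trans (enormD _ _) _; rewrite enormN y1 e1.
have be : open_ball x eta (x + t *: e) by apply: open_ball_shift; rewrite tn.
have by' : open_ball x eta (x + t *: y) by apply: open_ball_shift; rewrite tn.
have T := @second_order_taylor (x + t *: e) (t *: (y - e)) be.
rewrite -addrA -scalerDr subrKC enormZ [`|t|]gtr0_norm// -/a in T.
have {T} := le_trans (ler_norm _) (T by').
(* [gradient_diff_le] wants a direction as long as t e, so y - e is rescaled to length t and the
   factor a is restored afterwards. *)
have g : dotv (G (x + t *: e) - G x) (t / a *: (y - e)) <= 3 * M * enorm (t *: e) ^+ 2.
  apply: gradient_diff_le; first by rewrite tn.
  by rewrite enormZ -/a (tn _ e1) gtr0_norm ?divr_gt0// divfK.
have {g} : dotv (G (x + t *: e) - G x) (t *: (y - e)) <= 3 * M * t ^+ 2 * a.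
  move: g; rewrite tn// !dotvZr -(ler_pM2r ap); congr (_ <= _).
  by rewrite mulrAC divfK.
rewrite dotvDl dotvNl !dotvZr exprMn => g T.
have : M * t ^+ 2 * a ^+ 2 <= M * t ^+ 2 * (2 * a).
  apply: ler_wpM2l; first by rewrite mulr_ge0 ?sqr_ge0.
  by rewrite expr2 ler_pM2r.
lra.
Qed.

Lemma taylor_sphere y t : enorm y = 1 -> 0 < t -> t < eta ->
  `|phi (x + t *: y) - phi x - t * dotv (G x) y| <= M / 2 * t ^+ 2.
Proof.
move=> y1 t0 teta.
have eta0 : 0 < eta by exact: lt_trans teta.
have := @second_order_taylor x (t *: y); rewrite enormZ y1 mulr1 [`|t|]gtr0_norm// dotvZr; apply.
  by have := @open_ball_shift 0; rewrite addr0 enorm0; apply.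
by apply: open_ball_shift; rewrite enormZ y1 mulr1 gtr0_norm.
Qed.

End C2.

(** Serves both to bound the Hessian entries along a radius of the ball and to follow an arc outside
    it. *)
Lemma chain_le (T : Type) (f : T -> R) (p : nat -> T) (c : R) (n : nat) :
  (forall k, (k < n)%N -> `|f (p k.+1) - f (p k)| <= c) ->
  `|f (p n) - f (p 0%N)| <= n%:R * c.
Proof.
elim: n => [|n IH] H; first by rewrite subrr normr0 mul0r.
have -> : f (p n.+1) - f (p 0%N) = (f (p n.+1) - f (p n)) + (f (p n) - f (p 0%N)) by ring.
apply: le_trans (ler_normD _ _) _; rewrite -natr1 mulrDl mul1r addrC lerD//; last exact: H.
by apply: IH => k kn; apply: H; exact: ltn_trans kn _.
Qed.

(** The segment from x to w is cut into n steps shorter than d, each changing f by at most 1, with n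
    independent of w. *)
Lemma ucont_on_ball_bounded (f : V -> R) (x : V) (eta : R) : 0 < eta ->
  ucont_on (open_ball x eta) f -> exists B, forall w, open_ball x eta w -> `|f w| <= B.
Proof.
move=> eta0 /(_ 1 ltr01)[d d0 H]; pose n := (Num.trunc (eta / d)).+1.
have n0 : 0 < n%:R :> R by rewrite ltr0n.
have nd : eta / n%:R < d.
  by rewrite ltr_pdivrMr// mulrC -ltr_pdivrMr//; exact: truncnS_gt.
exists (n%:R * 1 + `|f x|) => w xw.
pose p (k : nat) := x + (k%:R / n%:R) *: (w - x).
have bp k : (k <= n)%N -> open_ball x eta (p k).
  move=> kn; apply: open_ball_convex.
  - by rewrite divr_ge0// ltW.
  - by rewrite ler_pdivrMr// mul1r ler_nat.
  - by rewrite /open_ball/= subrr enorm0.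
  - by rewrite subrKC.
have := @chain_le V f p 1 n.
rewrite /p divff ?gt_eqF// scale1r subrKC mul0r scale0r addr0 => /(_ _) h.
rewrite -[f w](subrK (f x)); apply: le_trans (ler_normD _ _) _; rewrite lerD2r; apply: h.
move=> k kn; apply/ltW/H; [exact: bp|exact/bp/ltnW|].
have -> : p k.+1 - p k = n%:R^-1 *: (w - x).
  by apply/rowP => i; rewrite !mxE -natr1; field; exact: lt0r_neq0.
rewrite enormZ gtr0_norm ?invr_gt0// mulrC; apply: le_lt_trans nd.
by rewrite ler_pM2r ?invr_gt0// ltW.
Qed.

(** * Finiteness of C_x and the Hessian bound *)

Section Cx.
Variables (Hs : V -> 'M[R]_N) (x : V) (eta : R).
Hypothesis eta0 : 0 < eta.
Hypothesis hHs : forall i j, ucont_on (open_ball x eta) (fun w => Hs w i j).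

Let S := [set r | exists w z, [/\ open_ball x eta w, @unit_sphere R N z &
                       r = `|(z *m Hs w *m z^T) 0 0|]].

(** Without an upper bound, [sup] would not dominate the set and C_x would bound nothing. Uniform
    continuity bounds each entry of the Hessian on the ball. *)
Lemma hessian_form_has_ubound : has_ubound S.
Proof.
have /choice[B hB] : forall ij : 'I_N * 'I_N, exists B, forall w, open_ball x eta w -> `|Hs w ij.1 ij.2| <= B.
  by move=> ij; exact: (ucont_on_ball_bounded eta0 (hHs ij.1 ij.2)).
exists (\sum_(j < N) \sum_(i < N) B (i, j)) => _ [w [z [xw z1 ->]]].
rewrite mxE; apply: le_trans (ler_norm_sum _ _ _) _; apply: ler_sum => j _.
have zc i : `|z 0 i| <= 1 by rewrite -z1; exact: abs_coord_le.
rewrite normrM mxE [z^T _ _]mxE.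
apply: (@le_trans _ _ (`|\sum_(i < N) z 0 i * Hs w i j|)).
  by rewrite ler_piMr.
apply: le_trans (ler_norm_sum _ _ _) _; apply: ler_sum => i _.
rewrite normrM; apply: le_trans (hB (i, j) w xw).
by rewrite ler_piMl.
Qed.

Lemma Cx_ge0 : 0 <= Cx x eta Hs.
Proof.
rewrite /Cx -/S mulr_ge0//.
have [->|/set0P[r Sr]] := eqVneq S set0; first by rewrite sup0.
apply: (@le_trans _ _ r); last exact: (ub_le_sup hessian_form_has_ubound).
by case: Sr => w [z [_ _ ->]].
Qed.

(** By homogeneity of degree 2 it suffices to treat unit vectors. Hence M = 2 C_x in the Taylor
    estimates. *)
Lemma hessian_form_le w z : open_ball x eta w ->
  `|(z *m Hs w *m z^T) 0 0| <= 2 * Cx x eta Hs * enorm z ^+ 2.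
Proof.
move=> xw; have [->|z0] := eqVneq z 0.
  by rewrite mul0mx mul0mx mxE normr0 enorm0 expr0n mulr0.
have zp : 0 < enorm z by rewrite enorm_gt0.
have -> : 2 * Cx x eta Hs = sup S by rewrite /Cx mulVKf.
have [u zu u1] : exists2 u, z = enorm z *: u & enorm u = 1.
  exists ((enorm z)^-1 *: z); first by rewrite scalerA divff ?scale1r// gt_eqF.
  by rewrite enormZ gtr0_norm ?invr_gt0// mulVf// gt_eqF.
move: (enorm z) zp zu => c c0 ->.
have -> k : (k *: u) *m Hs w *m (k *: u)^T = k ^+ 2 *: (u *m Hs w *m u^T).
  rewrite -!scalemxAl (_ : (k *: u)^T = k *: u^T); last first.
    by apply/matrixP => i j; rewrite !mxE.
  by rewrite -scalemxAr scalerA -expr2.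
rewrite mxE normrM.
rewrite [X in X * _]ger0_norm ?sqr_ge0// mulrC ler_wpM2r ?sqr_ge0//.
apply: (ub_le_sup hessian_form_has_ubound).
by exists w, u.
Qed.

End Cx.
End TaylorConsequences.

(** * The modulus of continuity outside the ball *)

Section Arc.
Context {R : realType}.
Implicit Types w d t c : R.

Lemma sin_MVT w : 0 <= w -> exists2 c, 0 <= c <= w & sin w = cos c * w.
Proof.
move=> w0; have [|c] := @MVT_segment R sin cos 0 w w0 (fun x _ => is_derive_sin x).
  by apply: continuous_subspaceT; exact: continuous_sin.
by rewrite in_itv/= sin0 !subr0 => cw ->; exists c.
Qed.

(** The mean value theorem gives sin w = w cos c with c <= w, and the cosine decreases on
    [0, pi]. *)
Lemma mul_cos_le_sin w : 0 <= w -> w <= pi -> w * cos w <= sin w.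
Proof.
move=> w0 wpi; have [c /andP[c0 cw] ->] := sin_MVT w0.
rewrite mulrC ler_wpM2r//; move: cw; rewrite le_eqVlt => /predU1P[->//|cw].
apply: ltW; rewrite ltr_cos// in_itv/= ?c0 ?w0//=; exact: (le_trans (ltW cw)).
Qed.

(** A chord is no longer than its arc: the left side is the squared chord 4 sin^2 (d/2). *)
Lemma one_sub_cos_le d : 0 <= d -> 2 - 2 * cos d <= d ^+ 2.
Proof.
move=> d0; have -> : d = (d / 2) *+ 2 by rewrite mulr2n -splitr.
rewrite cos_mulr2n cos2sin2.
have d20 : 0 <= d / 2 by rewrite divr_ge0.
have : sin (d / 2) ^+ 2 <= (d / 2) ^+ 2.
  have [c _ E] := sin_MVT d20.
  rewrite E exprMn ler_piMl ?sqr_ge0// -[leRHS](cos2Dsin2 c) lerDl sqr_ge0//.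
by lra.
Qed.

(* The chord is at least half as long as the arc. *)
Lemma arc_le_chord w : 0 <= w -> w <= pi -> w ^+ 2 <= 4 * (2 - 2 * cos w).
Proof.
(* As 2 - 2 cos w = 4 sin^2 (2v), the claim reduces to v <= sin (2v). Now sin (2v) = 2 sin v cos v
   >= 2 v cos^2 v, and 2 cos^2 v >= 1 because cos (2v) >= 0. *)
move=> w0 wpi; pose v := w / 4.
have v0 : 0 <= v by rewrite divr_ge0.
have pi0 := @pi_ge0 R.
have vpi : v <= pi by rewrite /v; lra.
have vpi2 : - (pi / 2) <= v <= pi / 2 by rewrite /v; apply/andP; split; lra.
have c2 : 0 <= cos (v *+ 2).
  by apply: cos_ge0_pihalf; rewrite /v; apply/andP; split; lra.
have h : v <= sin (v *+ 2).
  rewrite sin_mulr2n; rewrite cos_mulr2n in c2.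
  have cv : 0 <= cos v by exact: cos_ge0_pihalf.
  have h1 := mul_cos_le_sin v0 vpi.
  have h2 : v * cos v * cos v <= sin v * cos v by rewrite ler_wpM2r.
  have h3 : 0 <= v * (cos v ^+ 2 *+ 2 - 1) by rewrite mulr_ge0.
  by lra.
have -> : w = (v *+ 2) *+ 2 by rewrite /v; field.
have h' : v ^+ 2 <= sin (v *+ 2) ^+ 2.
  by rewrite ler_pXn2r// nnegrE// (le_trans v0).
rewrite (cos_mulr2n (v *+ 2)) cos2sin2; move: h'; lra.
Qed.
End Arc.

Section Chain.
Context {R : realType} {N : nat}.
Local Notation V := 'rV[R]_N.
Implicit Types (u v w e y z : V).

Lemma exists_unit_orthogonal e : (1 < N)%N -> exists2 v, enorm v = 1 & dotv v e = 0.
Proof.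
move=> N1; have : kermx e^T != 0.
  rewrite -mxrank_eq0 mxrank_ker -lt0n subn_gt0; apply: leq_ltn_trans N1.
  exact: rank_leq_col.
move/rowV0Pn => [v /sub_kermxP ve v0].
have nv : 0 < enorm v by rewrite enorm_gt0.
exists ((enorm v)^-1 *: v).
  by rewrite enormZ gtr0_norm ?invr_gt0// mulVf// gt_eqF.
rewrite dotvZl; suff -> : dotv v e = 0 by rewrite mulr0.
move/matrixP: ve => /(_ 0 0); rewrite !mxE => <-.
by apply: eq_bigr => i _; rewrite mxE.
Qed.

(** The angle is acos (e.y) and v is the normalized component w of y orthogonal to e; |w| is the
    sine of the angle. *)
Lemma unit_polar e y : (1 < N)%N -> enorm e = 1 -> enorm y = 1 ->
  exists v th, [/\ enorm v = 1, dotv v e = 0, 0 <= th, th <= pi &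
                y = cos th *: e + sin th *: v].
Proof.
move=> N1 e1 y1; pose c := dotv e y.
have [w wE] : exists w, w = y - c *: e by eexists.
have ee : dotv e e = 1 by rewrite -sqr_enorm e1 expr1n.
have yy : dotv y y = 1 by rewrite -sqr_enorm y1 expr1n.
have we : dotv w e = 0 by rewrite wE !dotvE ee dotvC -/c mulr1 subrr.
have ww : enorm w ^+ 2 = 1 - c ^+ 2.
  by rewrite sqr_enorm wE !dotvE yy ee (dotvC y e) -/c; ring.
have c1 : -1 <= c <= 1 by rewrite -ler_norml; have := cauchy_schwarz e y; rewrite e1 y1 mulr1.
have sinE : sin (acos c) = enorm w.
  by rewrite sin_acos// -ww sqrtr_sqr ger0_norm ?enorm_ge0.
(* If w = 0 then y is e or - e, the sine vanishes and any unit vector orthogonal to e will do. *)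
have [w0|w0] := eqVneq w 0.
  have [v v1 ve] := exists_unit_orthogonal e N1.
  exists v, (acos c); split => //; [exact: acos_ge0|exact: acos_lepi|].
  rewrite acosK ?in_itv// sinE w0 enorm0 scale0r addr0.
  by apply/eqP; rewrite -subr_eq0 -wE w0.
have wp : 0 < enorm w by rewrite enorm_gt0.
exists ((enorm w)^-1 *: w), (acos c); split; [| |exact: acos_ge0|exact: acos_lepi|].
- by rewrite enormZ gtr0_norm ?invr_gt0// mulVf// gt_eqF.
- by rewrite dotvZl we mulr0.
- by rewrite acosK ?in_itv// sinE scalerA divff ?gt_eqF// scale1r wE subrKC.
Qed.

Section Omega.
Variables (phi : V -> R) (x : V) (eta : R).
Hypothesis phi_bounded : exists M : R, forall z, `|phi z| <= M.

Let S (a : R) := [set r | exists z w, [/\ outside_ball x eta z, outside_ball x eta w,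
                              enorm (z - w) <= a & r = `|phi z - phi w|]].

Lemma omega_has_ubound a : has_ubound (S a).
Proof.
have [M hM] := phi_bounded; exists (M + M) => _ [z [w [_ _ _ ->]]].
by apply: le_trans (ler_normB _ _) _; exact: lerD.
Qed.

Lemma le_omega z w (a : R) : outside_ball x eta z -> outside_ball x eta w ->
  enorm (z - w) <= a -> `|phi z - phi w| <= omega phi x eta a.
Proof.
by move=> xz xw za; apply: (ub_le_sup (omega_has_ubound a)); exists z, w.
Qed.

Lemma omega_ge0 (a : R) : 0 <= omega phi x eta a.
Proof.
rewrite /omega -/(S a); have [->|/set0P[r Sr]] := eqVneq (S a) set0; first by rewrite sup0.
apply: (@le_trans _ _ r); last exact: (ub_le_sup (omega_has_ubound a)).
by case: Sr => w [z [_ _ _ ->]].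
Qed.

Lemma omega_le (a b : R) : a <= b -> omega phi x eta a <= omega phi x eta b.
Proof.
move=> ab; rewrite {1}/omega -/(S a).
(* For instance a < 0 makes the set empty; its supremum is then 0 by convention. *)
have [->|/set0P Sa] := eqVneq (S a) set0; first by rewrite sup0 omega_ge0.
apply: ge_sup => // _ [z [w [xz xw za ->]]].
by apply: le_omega => //; exact: le_trans ab.
Qed.

Hypothesis N1 : (1 < N)%N.

(* The exterior of the ball is not convex: the chain follows the great circle through
   [e] and [y], of length at most [2 t |y - e|]. *)
Lemma sphere_chain_le e y (t : R) : enorm e = 1 -> enorm y = 1 -> 0 < t -> eta < t ->
  `|phi (x + t *: y) - phi (x + t *: e)| <= (2 * omega phi x eta (enorm (y - e))) * (1 + t).
Proof.
move=> e1 y1 t0 teta; have [v [th [v1 ve th0 thpi yE]]] := unit_polar N1 e1 y1.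
set a := enorm (y - e).
have ee : dotv e e = 1 by rewrite -sqr_enorm e1 expr1n.
have vv : dotv v v = 1 by rewrite -sqr_enorm v1 expr1n.
have ev : dotv e v = 0 by rewrite dotvC.
pose g r : V := cos r *: e + sin r *: v.
have chord r q : enorm (g r - g q) ^+ 2 = 2 - 2 * cos (r - q).
  rewrite sqr_enorm /g !dotvE ee vv ve ev cosB.
  have := cos2Dsin2 r; have := cos2Dsin2 q; nra.
have g1 r : enorm (g r) = 1.
  apply/eqP; rewrite -(@eqrXn2 _ 2)// ?enorm_ge0// expr1n sqr_enorm /g !dotvE ee vv ve ev.
  by apply/eqP; have := cos2Dsin2 r; nra.
have ya : y = g th by [].
have ea : e = g 0 by rewrite /g cos0 sin0 scale1r scale0r addr0.
have tha : th <= 2 * a.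
  rewrite -(@ler_pXn2r _ 2)// ?nnegrE ?mulr_ge0 ?enorm_ge0// exprMn /a {1}ya ea chord subr0.
  apply: le_trans (arc_le_chord th0 thpi) _; lra.
(* With n > 2t each arc t th / n is at most a, since th <= 2a; and n <= 2 (1 + t) gives the factor
   in the bound. *)
pose n := (Num.trunc (2 * t)).+1.
have nt : 2 * t < n%:R by exact: truncnS_gt.
have n0 : 0 < n%:R :> R by rewrite ltr0n.
have nt' : n%:R <= 2 * (1 + t).
  have h : (Num.trunc (2 * t))%:R <= 2 * t by rewrite truncn_le mulr_ge0// ltW.
  by rewrite /n -natr1; lra.
pose p (k : nat) := x + t *: g (k%:R / n%:R * th).
have out r : outside_ball x eta (x + t *: g r).
  by rewrite /outside_ball/= addrAC subrr add0r enormZ g1 mulr1 gtr0_norm.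
have := @chain_le R V phi p (omega phi x eta a) n.
rewrite /p divff ?gt_eqF// mul1r -ya !mul0r -ea => H.
apply: (le_trans (H _)); last first.
  by rewrite mulrAC ler_wpM2r// omega_ge0.
move=> k kn; apply: le_omega; [exact: out|exact: out|].
rewrite opprD addrACA subrr add0r -scalerBr enormZ gtr0_norm//.
rewrite -(@ler_pXn2r _ 2)// ?nnegrE ?mulr_ge0 ?enorm_ge0 ?(ltW t0)//.
rewrite exprMn chord.
have -> : k.+1%:R / n%:R * th - k%:R / n%:R * th = th / n%:R.
  by rewrite -natr1; field; exact: lt0r_neq0.
apply: (@le_trans _ _ (t ^+ 2 * (th / n%:R) ^+ 2)).
  by rewrite ler_wpM2l ?sqr_ge0// one_sub_cos_le// divr_ge0// ltW.
rewrite -exprMn ler_pXn2r// ?nnegrE ?enorm_ge0 ?mulr_ge0 ?divr_ge0 ?(ltW t0) ?(ltW n0)//.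
rewrite mulrA ler_pdivrMr//.
have : t * th <= t * (2 * a) by rewrite ler_wpM2l// ltW.
have : a * (2 * t) <= a * n%:R by rewrite ler_wpM2l ?enorm_ge0// ltW.
lra.
Qed.

End Omega.
End Chain.

(** * The singular limit *)

Section SingularLimit.
Context {R : realType}.
Variable s : R.
Hypotheses (hs1 : 2^-1 < s) (hs2 : s < 1).
Implicit Types (psi : R -> R) (c K eps : R).

Let h psi (d : R) := wint s `]d, +oo[ psi.

Lemma wint_diff_le psi c K eps d d' : bounded_meas psi ->
  (forall t, 0 < t -> t < eps -> psi t <= c * t + K * t ^+ 2) ->
  0 < d -> d < d' -> d' <= eps ->
  h psi d - h psi d' <= c * ((d `^ (1 - 2 * s) - d' `^ (1 - 2 * s)) / (2 * s - 1))
     + K * ((d' `^ (2 - 2 * s) - d `^ (2 - 2 * s)) / (2 * (1 - s))).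
Proof.
move=> bpsi H d0 dd' d'e; rewrite /h (wint_split hs1 d0 dd' bpsi) addrK.
apply: wint_itv_le => // t dt td'; apply: H; [exact: lt_trans dt|exact: lt_le_trans d'e].
Qed.

Lemma bounded_measN psi : bounded_meas psi -> bounded_meas (fun t => - psi t).
Proof.
by move=> /(bounded_measZ (-1)); under eq_fun do rewrite mulN1r.
Qed.

Lemma wintN psi d : 0 < d -> bounded_meas psi -> h (fun t => - psi t) d = - h psi d.
Proof.
move=> d0 bpsi; rewrite -mulN1r -wintZ//.
by congr (wint _ _ _); apply/funext => t; rewrite mulN1r.
Qed.

Lemma wint_diff_ge psi c K eps d d' : bounded_meas psi ->
  (forall t, 0 < t -> t < eps -> c * t - K * t ^+ 2 <= psi t) ->
  0 < d -> d < d' -> d' <= eps ->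
  c * ((d `^ (1 - 2 * s) - d' `^ (1 - 2 * s)) / (2 * s - 1))
     - K * ((d' `^ (2 - 2 * s) - d `^ (2 - 2 * s)) / (2 * (1 - s))) <= h psi d - h psi d'.
Proof.
move=> bpsi H d0 dd' d'e; have d'0 := lt_trans d0 dd'.
have H' t : 0 < t -> t < eps -> - psi t <= - c * t + K * t ^+ 2.
  by move=> t0 te; have := H t t0 te; lra.
have := wint_diff_le (bounded_measN bpsi) H' d0 dd' d'e.
by rewrite !wintN//; lra.
Qed.

Lemma powR_cvg_pinfty : d `^ (1 - 2 * s) @[d --> (0:R)^'+] --> +oo%R.
Proof.
have q0 : 0 < 2 * s - 1 by rewrite subr_gt0 twos_gt1.
have -> : (fun d : R => d `^ (1 - 2 * s)) = (fun d => (d `^ (2 * s - 1))^-1).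
  by apply/funext => d /=; rewrite -opprB powRN.
apply: (@cvgrVy _ _ _ _ (fun d : R => d `^ (2 * s - 1)) _).2; last exact: powR_cvg0.
by near=> d; apply: powR_gt0.
Unshelve. all: by end_near. Qed.

(** Between d and eps the linear term contributes c d^(1-2s) / (2s-1) up to a constant, which blows
    up because s > 1/2; the quadratic term stays bounded. *)
Lemma wint_cvg_pinfty psi c K eps : bounded_meas psi -> 0 < eps -> 0 < c -> 0 <= K ->
  (forall t, 0 < t -> t < eps -> c * t - K * t ^+ 2 <= psi t) ->
  h psi d @[d --> 0^'+] --> +oo%R.
Proof.
move=> bpsi e0 c0 K0 H.
have q0 : 0 < 2 * s - 1 by rewrite subr_gt0 twos_gt1.
pose k := c / (2 * s - 1).
have k0 : 0 < k by rewrite divr_gt0.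
pose C := h psi eps - k * eps `^ (1 - 2 * s) - K * (eps `^ (2 - 2 * s) / (2 * (1 - s))).
apply: (@ger_cvgy _ _ _ _ (fun d => k * d `^ (1 - 2 * s) + C)).
  near=> d.
  have d0 : 0 < d by [].
  have de : d < eps by near: d; exact: nbhs_right_lt.
  have := wint_diff_ge bpsi H d0 de (lexx _).
  have : 0 <= K * (d `^ (2 - 2 * s) / (2 * (1 - s))).
    by rewrite mulr_ge0 ?divr_ge0 ?powR_ge0 ?mulr_ge0 ?subr_ge0 ?(ltW hs2).
  rewrite /C /k mulrBl !mulrBr mulrBl !mulrBr; lra.
apply/cvgryPge => A.
have /cvgryPge/(_ ((A - C) / k)) := powR_cvg_pinfty.
apply: filterS => d; rewrite ler_pdivrMr// mulrC; lra.
Unshelve. all: by end_near. Qed.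

(** Subtracting the correction k d^(2-2s), which tends to 0, makes the integral monotone in d, so it
    converges to its supremum. *)
Lemma wint_cvg_fin psi K eps : bounded_meas psi -> 0 < eps -> 0 <= K ->
  (forall t, 0 < t -> t < eps -> `|psi t| <= K * t ^+ 2) ->
  exists2 l : R, h psi d @[d --> 0^'+] --> l &
    `|l - h psi eps| <= K * (eps `^ (2 - 2 * s) / (2 * (1 - s))).
Proof.
move=> bpsi e0 K0 H.
pose k := K / (2 * (1 - s)).
have k0 : 0 <= k by rewrite divr_ge0// mulr_ge0// subr_ge0 ltW.
have ub d d' : 0 < d -> d < d' -> d' <= eps ->
    h psi d - h psi d' <= k * d' `^ (2 - 2 * s) - k * d `^ (2 - 2 * s).
  move=> d0 dd' d'e; have := @wint_diff_le psi 0 K eps d d' bpsi _ d0 dd' d'e.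
  rewrite mul0r add0r mulrBl mulrBr /k.
  rewrite !(mulrAC K _ (_ `^ _)) -!mulrA; apply => t t0 te.
  by rewrite mul0r add0r; apply: le_trans (ler_norm _) _; exact: H.
have lb d d' : 0 < d -> d < d' -> d' <= eps ->
    - (k * d' `^ (2 - 2 * s) - k * d `^ (2 - 2 * s)) <= h psi d - h psi d'.
  move=> d0 dd' d'e; have := @wint_diff_ge psi 0 K eps d d' bpsi _ d0 dd' d'e.
  rewrite mul0r sub0r mulrBl mulrBr /k.
  rewrite !(mulrAC K _ (_ `^ _)) -!mulrA; apply => t t0 te.
  by rewrite mul0r sub0r; have := H t t0 te; rewrite ler_norml => /andP[].
have q0 : 0 < 2 - 2 * s by rewrite subr_gt0 gtr_pMr.
have kcvg : k * d `^ (2 - 2 * s) @[d --> 0^'+] --> 0.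
  by rewrite -[X in _ --> X](mulr0 k); apply: cvgMl_tmp; exact: powR_cvg0.
pose H' d := h psi d - k * d `^ (2 - 2 * s).
have cvH : H' d @[d --> 0^'+] --> sup (H' @` `]0, eps]).
  apply: nonincreasing_at_right_cvgr; first by rewrite bnd_simp.
    move=> d d'; rewrite !in_itv/= => /andP[d0 de] /andP[d'0 d'e].
    rewrite le_eqVlt => /predU1P[->//|dd'].
    by have := lb _ _ d0 dd' d'e; rewrite /H'; lra.
  exists (h psi eps + k * eps `^ (2 - 2 * s)); apply/ubP => _ [d + <-].
  rewrite /= in_itv/= => /andP[d0].
  have kd : 0 <= k * d `^ (2 - 2 * s) by rewrite mulr_ge0// powR_ge0.
  rewrite le_eqVlt => /predU1P[<-|de]; first by rewrite /H'; lra.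
  by have := ub _ _ d0 de (lexx _); rewrite /H'; lra.
set L := sup _ in cvH.
have cvh : h psi d @[d --> 0^'+] --> L.
  apply: (@cvg_trans _ ((H' d + k * d `^ (2 - 2 * s)) @[d --> 0^'+])).
    by apply: near_eq_cvg; near=> d; rewrite /H' subrK.
  by rewrite -[L]addr0; exact: cvgD.
have KE : K * (eps `^ (2 - 2 * s) / (2 * (1 - s))) = k * eps `^ (2 - 2 * s).
  by rewrite /k mulrA mulrAC.
exists L => //; rewrite KE ler_norml; apply/andP; split.
  rewrite lerBrDr; apply: (cvgr_to_ge cvh); near=> d.
  have d0 : 0 < d by [].
  have de : d < eps by near: d; exact: nbhs_right_lt.
  have kd : 0 <= k * d `^ (2 - 2 * s) by rewrite mulr_ge0// powR_ge0.
  by have := lb _ _ d0 de (lexx _); lra.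
rewrite lerBlDr; apply: (cvgr_to_le cvh); near=> d.
have d0 : 0 < d by [].
have de : d < eps by near: d; exact: nbhs_right_lt.
have kd : 0 <= k * d `^ (2 - 2 * s) by rewrite mulr_ge0// powR_ge0.
by have := ub _ _ d0 de (lexx _); lra.
Unshelve. all: by end_near. Qed.

(** [lim] is total, so convergence has to be proved before its value can be read off; C_s > 0
    preserves the sign of the infinity. *)
Lemma lim_mu_int_pinfty psi c K eps : bounded_meas psi -> 0 < eps -> 0 < c -> 0 <= K ->
  (forall t, 0 < t -> t < eps -> c * t - K * t ^+ 2 <= psi t) ->
  lim (mu_int s d psi @[d --> 0^'+]) = +oo%E.
Proof.
move=> bpsi e0 c0 K0 H; apply: (@cvg_lim _ (@ereal_hausdorff R)).
apply: (@cvg_trans _ ((Cs s * h psi d)%:E @[d --> 0^'+])).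
  by apply: near_eq_cvg; near=> d; rewrite mu_int_wint.
apply/cvgeryP/cvgryPge => A.
have C0 : 0 < Cs s by apply: Cs_gt0 => //; apply: lt_trans hs1.
have /cvgryPge/(_ (A / Cs s)) := wint_cvg_pinfty bpsi e0 c0 K0 H.
by apply: filterS => d; rewrite ler_pdivrMr// mulrC.
Unshelve. all: by end_near. Qed.

Lemma lim_mu_int_ninfty psi c K eps : bounded_meas psi -> 0 < eps -> 0 < c -> 0 <= K ->
  (forall t, 0 < t -> t < eps -> psi t <= - c * t + K * t ^+ 2) ->
  lim (mu_int s d psi @[d --> 0^'+]) = -oo%E.
Proof.
move=> bpsi e0 c0 K0 H; apply: (@cvg_lim _ (@ereal_hausdorff R)).
apply: (@cvg_trans _ ((Cs s * h psi d)%:E @[d --> 0^'+])).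
  by apply: near_eq_cvg; near=> d; rewrite mu_int_wint.
apply/cvgerNyP/cvgrNyPle => A.
have C0 : 0 < Cs s by apply: Cs_gt0 => //; apply: lt_trans hs1.
have H' t : 0 < t -> t < eps -> c * t - K * t ^+ 2 <= - psi t.
  by move=> t0 te; have := H t t0 te; lra.
have /cvgryPge/(_ (- A / Cs s)) := wint_cvg_pinfty (bounded_measN bpsi) e0 c0 K0 H'.
move=> HA; near=> d; have d0 : 0 < d by [].
have : - A / Cs s <= h (fun t => - psi t) d by near: d.
by rewrite wintN// ler_pdivrMr// mulrC mulrN lerN2.
Unshelve. all: by end_near. Qed.

Lemma lim_mu_int_fin psi K eps : bounded_meas psi -> 0 < eps -> 0 <= K ->
  (forall t, 0 < t -> t < eps -> `|psi t| <= K * t ^+ 2) ->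
  exists2 l : R, lim (mu_int s d psi @[d --> 0^'+]) = l%:E &
    `|l - Cs s * h psi eps| <= Cs s * (K * (eps `^ (2 - 2 * s) / (2 * (1 - s)))).
Proof.
move=> bpsi e0 K0 H; have [l hl le] := wint_cvg_fin bpsi e0 K0 H.
have C0 : 0 < Cs s by apply: Cs_gt0 => //; apply: lt_trans hs1.
exists (Cs s * l); last by rewrite -mulrBr normrM gtr0_norm// ler_pM2l.
apply: (@cvg_lim _ (@ereal_hausdorff R)).
apply: (@cvg_trans _ ((Cs s * h psi d)%:E @[d --> 0^'+])).
  by apply: near_eq_cvg; near=> d; rewrite mu_int_wint.
by apply: cvg_EFin; [near=> d|apply: cvgMl_tmp].
Unshelve. all: by end_near. Qed.

End SingularLimit.

(** * Deviation from the gradient direction *)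

(* If [a > A] then each of the two error terms is at most half of the quadratic
   gain [n a ^ 2 D / 2]. *)
Lemma quadratic_gain_le (R : realFieldType) (n a A X D T w wA : R) :
  0 < n -> 0 <= a -> 0 <= X -> 0 < D -> 0 < T -> 0 <= wA ->
  16 * X / (n * D) <= A -> (a <= A -> w <= wA) ->
  (a ^+ 2 <= 8 * w * T / (n * D) -> a <= A) ->
  - (n * a ^+ 2 / 2) * D + 4 * X * a + 2 * w * T <= 4 * X * A + 2 * T * wA.
Proof.
move=> n0 a0 X0 D0 T0 wA0 AX wle aw.
have nD : 0 < n * D by rewrite mulr_gt0.
have A0 : 0 <= A by apply: le_trans AX; rewrite divr_ge0 ?mulr_ge0// ltW.
(* For a <= A the gain is dropped and both error terms are replaced by their values at A. *)
have [aA|Aa] := leP a A.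
  have h1 : 0 <= n * a ^+ 2 / 2 * D.
    by rewrite !mulr_ge0 ?invr_ge0 ?sqr_ge0 ?(ltW n0) ?(ltW D0).
  have h2 : w * T <= wA * T by rewrite ler_pM2r//; exact: wle.
  have h3 : X * a <= X * A by rewrite ler_wpM2l.
  lra.
have h0 : 0 <= wA * T by rewrite mulr_ge0// ltW.
have h0' : 0 <= X * A by rewrite mulr_ge0.
have h1 : 16 * X < a * (n * D) by rewrite -ltr_pdivrMr//; exact: le_lt_trans AX Aa.
have h2 : 8 * w * T < a ^+ 2 * (n * D).
  by rewrite -ltr_pdivrMr// ltNge; apply/negP => /aw; rewrite leNgt Aa.
have h3 : a * (16 * X) <= a * (a * (n * D)) by rewrite ler_wpM2l// ltW.
by move: h2 h3; rewrite expr2; lra.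
Qed.

Section Core.
Context {R : realType} {N : nat}.
Local Notation V := 'rV[R]_N.
Implicit Types (u v w e y z : V).

(** The sets with measurable preimage under the line form a sigma-algebra that contains the open
    sets. *)
Lemma measurable_line (phi : V -> R) (x y : V) : borel_fun phi ->
  measurable_fun [set: R] (fun t : R => phi (x + t *: y)).
Proof.
move=> bphi _ B mB; rewrite setTI.
pose l := fun t : R => x + t *: y.
have cl : continuous l.
  move=> t; apply: cvgD; first exact: cvg_cst.
  by apply: cvgZr_tmp; exact: cvg_id.
have : <<s [set U : set V | open U]>> `<=` [set A | measurable (l @^-1` A)].
  apply: smallest_sub; last first.
    by move=> U /= oU; apply: open_measurable; move/continuousP : cl; apply.
  split => /=.
  - by rewrite preimage_set0.
  - by move=> A mA; rewrite setTD preimage_setC; exact: measurableC.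
  - by move=> F mF; rewrite preimage_bigcup; exact: bigcup_measurable.
by move=> /(_ _ (bphi B mB)).
Qed.

Variable s : R.
Hypotheses (hs1 : 2^-1 < s) (hs2 : s < 1).
Variables (phi : V -> R) (x : V) (eta eps : R) (C : R).
Hypothesis phi_bounded : exists M : R, forall z, `|phi z| <= M.
Hypotheses (eps0 : 0 < eps) (epseta : eps < eta) (C0 : 0 <= C).

(** Against the weight t^(-1-2s), [tail] is the integral of 1 + t over (eta, oo), [D] that of t over
    (eps, eta), and [X] is 2 C times that of t^2 over (eps, eta). *)
Let tail := eta `^ (- 2 * s) / (2 * s) + eta `^ (1 - 2 * s) / (2 * s - 1).
Let D := (eps `^ (1 - 2 * s) - eta `^ (1 - 2 * s)) / (2 * s - 1).
Let X := C * ((eta `^ (2 - 2 * s) - eps `^ (2 - 2 * s)) / (1 - s)).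
Let om := omega phi x eta.

Let eta0 : 0 < eta. Proof. exact: lt_trans epseta. Qed.
Let s0 : 0 < s. Proof. exact: lt_trans hs1. Qed.
Let s2 : 0 < 2 * s - 1. Proof. by rewrite subr_gt0 twos_gt1. Qed.
Let s3 : 0 < 1 - s. Proof. by rewrite subr_gt0. Qed.

Let tail_gt0 : 0 < tail.
Proof. by rewrite addr_gt0// divr_gt0 ?powR_gt0// mulr_gt0. Qed.

Let D'_gt0 : 0 < eps `^ (1 - 2 * s) - eta `^ (1 - 2 * s).
Proof.
rewrite subr_gt0 -(opprB (2 * s)) !powRN ltf_pV2 ?posrE ?powR_gt0//.
by rewrite gt0_ltr_powR ?nnegrE// ltW.
Qed.

Let D_gt0 : 0 < D.
Proof. by rewrite divr_gt0. Qed.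

Let X_ge0 : 0 <= X.
Proof.
rewrite mulr_ge0// divr_ge0 ?(ltW s3)// subr_ge0 ge0_ler_powR ?nnegrE ?(ltW eps0) ?(ltW eta0) ?(ltW epseta)//.
by rewrite subr_ge0; have h := hs2; lra.
Qed.

(** The factor is twice the integral of the weight over (eps, oo); it turns E_eps into the right
    side of [quadratic_gain_le]. *)
Lemma Eeps_neq0 (p : V) : p != 0 -> eps `^ (- 2 * s) / s * Eeps s phi x eta p C eps =
  4 * X * Aeps_err s phi x eta p C eps + 2 * tail * om (Aeps_err s phi x eta p C eps).
Proof.
move=> p0; rewrite /Eeps (negbTE p0); set A := Aeps_err _ _ _ _ _ _ _; rewrite -/om.
rewrite mulrA (_ : eps `^ (- 2 * s) / s * eps `^ (2 * s) = s^-1); last first.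
  rewrite mulrAC -powRD; last by apply/implyP => _; rewrite gt_eqF.
  by rewrite mulNr addNr powRr0 mul1r.
rewrite /X /tail; field.
by rewrite ?gt_eqF.
Qed.

(** The two entries of the maximum A_eps are the two thresholds of [quadratic_gain_le]: the first is
    16 X / (|p| D), and kappa dominates every a in [0, 2] for which the exterior term can win. *)
Lemma deviation_le (p : V) (a : R) : p != 0 -> 0 <= a -> a <= 2 ->
  - (enorm p * a ^+ 2 / 2) * D + 4 * X * a + 2 * om a * tail <=
  4 * X * Aeps_err s phi x eta p C eps + 2 * tail * om (Aeps_err s phi x eta p C eps).
Proof.
move=> p0 a0 a2; have n0 : 0 < enorm p by rewrite enorm_gt0.
set A := Aeps_err _ _ _ _ _ _ _.
have omA : 0 <= om A by exact: omega_ge0.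
have oma : 0 <= om a by exact: omega_ge0.
have kub : has_ubound [set a | [/\ 0 <= a, a <= 2 &
     a ^+ 2 <= 8 * omega phi x eta a / enorm p *
       ((((2 * s - 1) / (2 * s)) * powR eta (- 2 * s) + powR eta (1 - 2 * s))
          / (powR eps (1 - 2 * s) - powR eta (1 - 2 * s)))]].
  by exists 2; apply/ubP => k [].
have kE k : 8 * omega phi x eta k / enorm p *
       ((((2 * s - 1) / (2 * s)) * powR eta (- 2 * s) + powR eta (1 - 2 * s))
          / (powR eps (1 - 2 * s) - powR eta (1 - 2 * s))) = 8 * om k * tail / (enorm p * D).
  rewrite /om /tail /D; field.
  by rewrite ?gt_eqF.
have A1E : 16 * C / enorm p * ((2 * s - 1) / (1 - s)) *
             ((powR eta (2 - 2 * s) - powR eps (2 - 2 * s))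
               / (powR eps (1 - 2 * s) - powR eta (1 - 2 * s))) = 16 * X / (enorm p * D).
  by rewrite /X /D; field; rewrite ?gt_eqF.
have AA1 : 16 * X / (enorm p * D) <= A by rewrite /A /Aeps_err A1E le_max lexx.
have Ak k : 0 <= k -> k <= 2 -> k ^+ 2 <= 8 * om k * tail / (enorm p * D) -> k <= A.
  move=> k0 k2 h; rewrite /A /Aeps_err le_max; apply/orP; right.
  by apply: (ub_le_sup kub); split => //; rewrite kE.
apply: quadratic_gain_le => //; [exact: omega_le|exact: Ak].
Qed.

(** The integral is split at eta. The coefficient 8 C a is the 4 M a of [sphere_diff_le] with M = 2
    C, and the growth outside is that of [sphere_chain_le]. *)
Lemma wint_deviation_le (f : R -> R) (p : V) (a : R) : p != 0 -> 0 <= a -> a <= 2 ->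
  bounded_meas f ->
  (forall t, 0 < t -> t < eta -> f t <= - (enorm p * a ^+ 2 / 2) * t + 8 * C * a * t ^+ 2) ->
  (forall t, eta < t -> f t <= 2 * om a * (1 + t)) ->
  wint s `]eps, +oo[ f <= eps `^ (- 2 * s) / s * Eeps s phi x eta p C eps.
Proof.
move=> p0 a0 a2 bf H1 H2; rewrite Eeps_neq0//.
apply: le_trans (deviation_le p0 a0 a2).
rewrite (wint_split hs1 eps0 epseta bf) lerD//; last first.
  by apply: wint_itvy_le => //; rewrite mulr_ge0//; exact: omega_ge0.
have := @wint_itv_le _ _ hs1 hs2 eps eta f (- (enorm p * a ^+ 2 / 2)) (8 * C * a) eps0 epseta bf.
move=> /(_ _) h; apply: le_trans (h _) _.
  by move=> t et te; apply: H1 => //; exact: lt_trans et.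
rewrite -/D lerD2l /X le_eqVlt; apply/orP; left; apply/eqP; field.
by rewrite ?gt_eqF.
Qed.

(** For p <> 0 this is the preceding bound with f = 0 and a = 0. *)
Lemma Eeps_ge0 (p : V) : 0 <= Eeps s phi x eta p C eps.
Proof.
have [p0|p0] := eqVneq p 0; first by rewrite /Eeps p0 eqxx.
have : 0 <= eps `^ (- 2 * s) / s * Eeps s phi x eta p C eps.
  apply: le_trans (wint_deviation_le (f := fun=> 0) p0 (lexx 0) _ (bounded_meas_cst 0) _ _) => //.
  - by rewrite /wint; under eq_Rintegral do rewrite mul0r; rewrite Rintegral_ge0.
  - by move=> t t0 _; rewrite expr0n !mulr0 !mul0r oppr0 mul0r addr0.
  - by move=> t te; rewrite mulr_ge0// ?mulr_ge0 ?omega_ge0// addr_ge0// ltW// (lt_trans eta0).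
by rewrite pmulr_rge0// divr_gt0// powR_gt0.
Qed.

End Core.

(** * The sup-inf operator and the average *)

Lemma exists_unit_vector (R : realType) (N : nat) : (0 < N)%N ->
  exists y : 'rV[R]_N, enorm y = 1.
Proof.
move=> N0; pose u : 'rV[R]_N := const_mx 1.
have u0 : 0 < enorm u.
  rewrite enorm_gt0; apply/eqP => /rowP/(_ (Ordinal N0)); rewrite !mxE.
  by move/eqP; rewrite oner_eq0.
by exists ((enorm u)^-1 *: u); rewrite enormZ gtr0_norm ?invr_gt0// mulVf// gt_eqF.
Qed.

Lemma unit_vector1 (R : realType) (N : nat) (e y : 'rV[R]_N) : (N <= 1)%N ->
  enorm e = 1 -> enorm y = 1 -> y = e \/ y = - e.
Proof.
case: N e y => [|[|//]] e y _ e1 y1.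
  by move: e1; rewrite (_ : e = 0) ?enorm0 => [/esym/eqP|]; [rewrite oner_eq0|apply/rowP => -[]].
have sq (u : 'rV[R]_1) : enorm u = 1 -> u 0 0 ^+ 2 = 1.
  by move=> u1; rewrite expr2 -[RHS](expr1n _ 2) -u1 sqr_enorm /dotv big_ord1.
have : y 0 0 ^+ 2 == e 0 0 ^+ 2 by rewrite !sq.
rewrite eqf_sqr => /orP[|] /eqP E; [left|right];
  by apply/rowP => i; rewrite ord1 ?mxE.
Qed.

Section Main.
Context {R : realType} {N : nat}.
Local Notation V := 'rV[R]_N.
Implicit Types (u v w e y yt z : V).
Variable s : R.
Hypotheses (hN : (0 < N)%N) (hs1 : 2^-1 < s) (hs2 : s < 1).
Variables (phi : V -> R) (x : V) (eta : R) (G : V -> V) (Hs : V -> 'M[R]_N).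
Hypotheses (heta : 0 < eta) (hH : hypH phi x eta G Hs).
Variable eps : R.
Hypotheses (heps0 : 0 < eps) (heps1 : eps < eta).

Let C := Cx x eta Hs.
Let p := G x.
(** [m] is the mass mu_s (eps, oo), and [J0] the same mass without the factor C_s. *)
Let J0 := eps `^ (- 2 * s) / (2 * s).
Let m := Cs s * J0.

Let s0 : 0 < s. Proof. exact: lt_trans hs1. Qed.
Let Cs0 : 0 < Cs s. Proof. exact: Cs_gt0. Qed.
Let J00 : 0 < J0. Proof. by rewrite divr_gt0 ?powR_gt0// mulr_gt0. Qed.
Let m0 : 0 < m. Proof. by rewrite mulr_gt0. Qed.
Let phi_bounded : exists M : R, forall z, `|phi z| <= M.
Proof. by case: hH. Qed.

Let hC2 w : open_ball x eta w ->
  [/\ differentiable phi w, (forall h, 'D_h phi w = dotv (G w) h),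
      differentiable G w & (forall h, 'D_h G w = h *m Hs w)].
Proof. by case: hH => _ _ [H _ _ _] _; exact: H. Qed.

Let hHs : forall i j, ucont_on (open_ball x eta) (fun w => Hs w i j).
Proof. by case: hH => _ _ []. Qed.

Let C0 : 0 <= C. Proof. exact: Cx_ge0. Qed.
Let M0 : 0 <= 2 * C. Proof. by rewrite mulr_ge0. Qed.

Let hM w z : open_ball x eta w ->
  `|(z *m Hs w *m z^T) 0 0| <= 2 * C * enorm z ^+ 2.
Proof. exact: hessian_form_le. Qed.

Let ray y := fun t : R => phi (x + t *: y).

Let bounded_meas_ray y : bounded_meas (ray y).
Proof.
split; first by apply: measurable_line; case: hH.
by have [M hM'] := phi_bounded; exists M => t; exact: hM'.
Qed.

Let F y := wint s `]eps, +oo[ (ray y).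

Lemma mu_avgE y : mu_avg s eps (ray y) = F y / J0.
Proof.
rewrite /mu_avg /mu_mass !mu_int_wint//=; last exact: bounded_meas_cst.
by rewrite wint1// -/J0 -mulf_div divff ?mul1r// gt_eqF.
Qed.

(** Arranged for the linearity of [wint]; yt enters only through its antipode, which ranges over the
    same sphere. *)
Lemma LphiE y yt :
  (fun t => Lphi phi x (t *: y) (t *: yt)) =
  (fun t => (ray y t + ray (- yt) t) + (- 2 * phi x) * 1).
Proof. by apply/funext => t; rewrite /Lphi /ray scalerN mulr1 mulNr. Qed.

Lemma bounded_meas_Lphi y yt : bounded_meas (fun t => Lphi phi x (t *: y) (t *: yt)).
Proof.
rewrite LphiE; apply: bounded_measD; first exact: bounded_measD.
by apply: bounded_measZ; exact: bounded_meas_cst.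
Qed.

Lemma wint_Lphi y yt :
  wint s `]eps, +oo[ (fun t => Lphi phi x (t *: y) (t *: yt)) =
  F y + F (- yt) - 2 * phi x * J0.
Proof.
have b1 : bounded_meas (fun=> 1 : R) by exact: bounded_meas_cst.
rewrite LphiE wintD//; [|exact: bounded_measD|exact: bounded_measZ].
by rewrite wintD// wintZ// wint1// -/J0 !mulNr.
Qed.

Lemma Lphi_taylor y yt t : enorm y = 1 -> enorm yt = 1 -> 0 < t -> t < eta ->
  `|Lphi phi x (t *: y) (t *: yt) - dotv p (y - yt) * t| <= 2 * C * t ^+ 2.
Proof.
move=> y1 yt1 t0 te; have := taylor_sphere hC2 hM y1 t0 te.
have yt1' : enorm (- yt) = 1 by rewrite enormN.
have := taylor_sphere hC2 hM yt1' t0 te.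
rewrite /Lphi -/p dotvDr !dotvNr scalerN mulrN => T1 T2.
have -> : phi (x + t *: y) + phi (x - t *: yt) - 2 * phi x - (dotv p y - dotv p yt) * t =
  (phi (x + t *: y) - phi x - t * dotv p y) +
  (phi (x - t *: yt) - phi x - - (t * dotv p yt)) by ring.
apply: le_trans (ler_normD _ _) _; apply: le_trans (lerD T2 T1) _; lra.
Qed.

(** The integral of 2 C t^2 d mu_s over (0, eps): the cost of ignoring the part near 0 when the
    linear terms cancel. *)
Let r := Cs s * (2 * C * (eps `^ (2 - 2 * s) / (2 * (1 - s)))).

Lemma Lint_fin y yt : enorm y = 1 -> enorm yt = 1 -> dotv p (y - yt) = 0 ->
  exists2 l : R, Lint s phi x y yt = l%:E &
    `|l - Cs s * (F y + F (- yt) - 2 * phi x * J0)| <= r.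
Proof.
move=> y1 yt1 pz; rewrite -wint_Lphi; apply: lim_mu_int_fin => //.
  exact: bounded_meas_Lphi.
move=> t t0 te; have := Lphi_taylor y1 yt1 t0 (lt_trans te heps1).
by rewrite pz mul0r subr0.
Qed.

Lemma Lint_pinfty y yt : enorm y = 1 -> enorm yt = 1 -> 0 < dotv p (y - yt) ->
  Lint s phi x y yt = +oo%E.
Proof.
move=> y1 yt1 pz; apply: (@lim_mu_int_pinfty _ _ hs1 hs2 _ (dotv p (y - yt)) (2 * C) eta) => //.
  exact: bounded_meas_Lphi.
move=> t t0 te; have := Lphi_taylor y1 yt1 t0 te.
by rewrite ler_norml => /andP[+ _]; lra.
Qed.

Lemma Lint_ninfty y yt : enorm y = 1 -> enorm yt = 1 -> dotv p (y - yt) < 0 ->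
  Lint s phi x y yt = -oo%E.
Proof.
move=> y1 yt1 pz; apply: (@lim_mu_int_ninfty _ _ hs1 hs2 _ (- dotv p (y - yt)) (2 * C) eta) => //.
  exact: bounded_meas_Lphi.
  by rewrite oppr_gt0.
move=> t t0 te; have := Lphi_taylor y1 yt1 t0 te.
by rewrite ler_norml => /andP[_]; lra.
Qed.

Let T := [set a | exists2 y, @unit_sphere R N y & a = mu_avg s eps (fun t => phi (x + t *: y))].

(** Makes the supremum and infimum over the sphere genuine. The crude bound M <= M (1 + t) allows
    [wint_itvy_le] to be reused. *)
Lemma F_bounded : exists B, forall y, `|F y| <= B.
Proof.
have [M hM'] := phi_bounded.
have Mge0 : 0 <= M by apply: le_trans (hM' 0).
exists (M * (eps `^ (- 2 * s) / (2 * s) + eps `^ (1 - 2 * s) / (2 * s - 1))) => y.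
have ub f : bounded_meas f -> (forall t, f t <= M) -> wint s `]eps, +oo[ f <=
    M * (eps `^ (- 2 * s) / (2 * s) + eps `^ (1 - 2 * s) / (2 * s - 1)).
  move=> bf fM; apply: wint_itvy_le => // t et; apply: le_trans (fM t) _.
  by rewrite ler_peMr// lerDl ltW// (lt_trans _ et).
rewrite ler_norml; apply/andP; split; last first.
  by apply: ub => // t; exact: le_trans (ler_norm _) (hM' _).
rewrite lerNl /F -wintN//; apply: ub; first exact: bounded_measN.
by move=> t; rewrite lerNl; have := hM' (x + t *: y); rewrite ler_norml => /andP[].
Qed.

Let avg_bounded : exists B, forall a, T a -> `|a| <= B.
Proof.
have [B hB] := F_bounded; exists (B / J0) => _ [y _ ->]; rewrite mu_avgE.
by rewrite normrM [X in _ * X]gtr0_norm ?invr_gt0// ler_pM2r ?invr_gt0.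
Qed.

Let T_ub : has_ubound T.
Proof.
have [B hB] := avg_bounded; exists B; apply/ubP => a /hB; exact: le_trans (ler_norm _).
Qed.

Let T_lb : has_lbound T.
Proof.
have [B hB] := avg_bounded; exists (- B); apply/lbP => a /hB.
by rewrite ler_norml => /andP[].
Qed.

Let T_neq0 : T !=set0.
Proof.
by have [y y1] := exists_unit_vector R hN; exists (mu_avg s eps (fun t => phi (x + t *: y))), y.
Qed.

Let S := sup T.
Let I := inf T.

Let F_le y : enorm y = 1 -> F y / J0 <= S.
Proof. by move=> y1; rewrite -mu_avgE; apply: (ub_le_sup T_ub); exists y. Qed.

Let F_ge y : enorm y = 1 -> I <= F y / J0.
Proof. by move=> y1; rewrite -mu_avgE; apply: (ge_inf T_lb); exists y. Qed.

Let S_le c : (forall y, enorm y = 1 -> F y / J0 <= c) -> S <= c.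
Proof. by move=> H; apply: ge_sup => // _ [y y1 ->]; rewrite mu_avgE; exact: H. Qed.

Let I_ge c : (forall y, enorm y = 1 -> c <= F y / J0) -> c <= I.
Proof. by move=> H; apply: lb_le_inf => // _ [y y1 ->]; rewrite mu_avgE; exact: H. Qed.

Let mF y : m * (F y / J0) = Cs s * F y.
Proof. by rewrite /m; field; rewrite gt_eqF. Qed.

(** With p = 0 every [Lint] is finite and within r, uniformly in y and yt, of a function of y plus a
    function of - yt. The supremum and the infimum therefore separate into S and I. *)
Lemma Ls_zero_gradient : p = 0 ->
  exists2 l : R, Ls s phi x = l%:E & `|l - m * (S + I - 2 * phi x)| <= r.
Proof.
move=> p0; have [y0 y01] := exists_unit_vector R hN.
have pz z : dotv p z = 0 by rewrite p0 -(scale0r (0 : V)) dotvZl mul0r.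
have up : (Ls s phi x <= (m * (S + I - 2 * phi x) + r)%:E)%E.
  apply: ge_ereal_sup => _ [y y1 ->].
  set K := ereal_inf _.
  have HK yt : enorm yt = 1 -> (K <= (Cs s * F (- yt) + (m * S - m * (2 * phi x) + r))%:E)%E.
    move=> yt1; have [l lE hl] := Lint_fin y1 yt1 (pz _).
    apply: (@le_trans _ _ l%:E); first by apply: ereal_inf_lbound; exists yt.
    rewrite lee_fin; move: hl; rewrite ler_norml => /andP[_].
    have h : m * (F y / J0) <= m * S by rewrite ler_pM2l//; exact: F_le.
    rewrite mF in h; have mE : Cs s * (2 * phi x * J0) = m * (2 * phi x) by rewrite /m; ring.
    by lra.
  (* The infimum is a priori an extended real: -oo is harmless and +oo is excluded by the unit
     vector y0. *)
  case: (K) HK => [k|H|_]; last by rewrite leNye.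
  - move=> H; rewrite lee_fin.
    have : (k - (m * S - m * (2 * phi x) + r)) / m <= I.
      apply: I_ge => y' y'1; rewrite ler_pdivrMr// [leRHS]mulrC mF lerBlDr.
      (* The direction y' is reached by the choice yt = - y'. *)
      by have := H (- y'); rewrite opprK enormN lee_fin; apply.
    by rewrite ler_pdivrMr//; lra.
  - by have := H _ y01; rewrite leNgt ltry.
have dn : ((m * (S + I - 2 * phi x) - r)%:E <= Ls s phi x)%E.
  have H y : enorm y = 1 -> ((m * (F y / J0 + I - 2 * phi x) - r)%:E <= Ls s phi x)%E.
    move=> y1; apply: (@le_trans _ _ (ereal_inf [set f | exists2 yt, @unit_sphere R N yt & f = Lint s phi x y yt])).
      apply: le_ereal_inf_tmp => _ [yt yt1 ->]; have [l -> hl] := Lint_fin y1 yt1 (pz _).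
      rewrite lee_fin; move: hl; rewrite ler_norml => /andP[+ _].
      have yt1' : enorm (- yt) = 1 by rewrite enormN.
      have h : m * I <= m * (F (- yt) / J0) by rewrite ler_pM2l//; exact: F_ge.
      rewrite mF in h; have mE : Cs s * (2 * phi x * J0) = m * (2 * phi x) by rewrite /m; ring.
      have -> : m * (F y / J0 + I - 2 * phi x) = Cs s * F y + m * I - m * (2 * phi x).
        by rewrite -mF; ring.
      by lra.
    by apply: ereal_sup_ubound; exists y.
  case: (Ls s phi x) H => [k|_|H]; last by have := H _ y01; rewrite leNgt ltNyr.
  - move=> H; rewrite lee_fin.
    have mE : m * ((k + r) / m - I + 2 * phi x) = k + r - m * I + m * (2 * phi x).
      by field; rewrite gt_eqF.
    have : m * S <= m * ((k + r) / m - I + 2 * phi x).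
      rewrite ler_pM2l//; apply: S_le => y y1; rewrite -(ler_pM2l m0) mE.
      by have := H y y1; rewrite lee_fin; lra.
    by rewrite mE; lra.
  - by rewrite leey.
case: (Ls s phi x) up dn => [k|//|//]; rewrite !lee_fin => up dn.
by exists k => //; rewrite ler_norml; apply/andP; split; lra.
Qed.

(** * The case of a nonzero gradient *)

Section NonzeroGradient.
Hypothesis p0 : p != 0.
Let e : V := (enorm p)^-1 *: p.

Let np : 0 < enorm p. Proof. by rewrite enorm_gt0. Qed.

Let e1 : enorm e = 1.
Proof. by rewrite enormZ gtr0_norm ?invr_gt0// mulVf// gt_eqF. Qed.

Let eN1 : enorm (- e) = 1. Proof. by rewrite enormN. Qed.

(** For unit vectors e.y = 1 - |y - e|^2 / 2. This is the source of the negative quadratic term. *)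
Lemma dotv_gradient_sub y : enorm y = 1 ->
  dotv p (y - e) = - (enorm p * enorm (y - e) ^+ 2 / 2).
Proof.
move=> y1; have pe : p = enorm p *: e by rewrite scalerA divff ?scale1r// gt_eqF.
have ee : dotv e e = 1 by rewrite -sqr_enorm e1 expr1n.
have yy : dotv y y = 1 by rewrite -sqr_enorm y1 expr1n.
move: (enorm p) e pe ee => n f -> ff.
by rewrite sqr_enorm !dotvE ff yy (dotvC y f); field.
Qed.

(** If y <> e, the reply yt = e makes the integral -oo; if y = e, every reply other than e gives
    +oo. Only the pair (e, e) remains. *)
Lemma Ls_nonzero_gradient :
  exists2 l : R, Ls s phi x = l%:E & `|l - m * (F e / J0 + F (- e) / J0 - 2 * phi x)| <= r.
Proof.
have sub y : enorm y = 1 -> y != e -> dotv p (y - e) < 0.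
  move=> y1 ye; rewrite dotv_gradient_sub// oppr_lt0 divr_gt0// mulr_gt0// exprn_gt0//.
  by rewrite enorm_gt0 subr_eq0.
have pee : dotv p (e - e) = 0 by rewrite subrr -(scale0r (0 : V)) dotvZr mul0r.
have [l lE hl] := Lint_fin e1 e1 pee.
exists l; last first.
  have -> : m * (F e / J0 + F (- e) / J0 - 2 * phi x) =
      Cs s * (F e + F (- e) - 2 * phi x * J0) by rewrite /m; field; rewrite gt_eqF.
  exact: hl.
have inf_e : ereal_inf [set f | exists2 yt, @unit_sphere R N yt & f = Lint s phi x e yt] = l%:E.
  apply/eqP; rewrite eq_le; apply/andP; split.
    by apply: ereal_inf_lbound; exists e.
  apply: le_ereal_inf_tmp => _ [yt yt1 ->].
  have [->|ye] := eqVneq yt e; first by rewrite lE.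
  rewrite Lint_pinfty ?leey//.
  by have := sub _ yt1 ye; rewrite -(opprB e) dotvNr oppr_lt0.
apply/eqP; rewrite eq_le; apply/andP; split; last first.
  by apply: ereal_sup_ubound; exists e.
apply: ge_ereal_sup => _ [y y1 ->].
have [->|ye] := eqVneq y e; first by rewrite inf_e.
apply: (@le_trans _ _ -oo%E); last exact: leNye.
by apply: ereal_inf_lbound; exists e => //; rewrite Lint_ninfty// sub.
Qed.

Let E := Eeps s phi x eta p C eps.

Lemma sup_inf_deviation : `|S + I - (F e / J0 + F (- e) / J0)| <= 2 * E.
Proof.
have E0 : 0 <= E by apply: Eeps_ge0.
have [N1|N1] := leqP N 1.
  (* In dimension 1 the larger of the two values is [S * J0] and the smaller [I * J0], so the sums
     agree. *)
  have all y : enorm y = 1 -> F y = F e \/ F y = F (- e).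
    by move=> y1; case: (unit_vector1 N1 e1 y1) => ->; [left|right].
  suff -> : S + I - (F e / J0 + F (- e) / J0) = 0 by rewrite normr0 mulr_ge0.
  have := F_le e1; have := F_le eN1; have := F_ge e1; have := F_ge eN1.
  have [h|h] := leP (F e / J0) (F (- e) / J0).
    have hS : S <= F (- e) / J0 by apply: S_le => y /all[->|->].
    have hI : F e / J0 <= I by apply: I_ge => y /all[->|->].
    by lra.
  have hS : S <= F e / J0 by apply: S_le => y /all[->|->] //; exact: ltW.
  have hI : F (- e) / J0 <= I by apply: I_ge => y /all[->|->] //; exact: ltW.
  by lra.
have JE : 2 * J0 * E = eps `^ (- 2 * s) / s * E.
  by rewrite /J0; field; rewrite gt_eqF.
(* Stated for a general pair, so as to serve for (y, e) in the supremum and for (- e, y) in the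
   infimum; in the latter - e - y = (- y) - e. *)
have dev y e' : enorm y = 1 -> enorm e' = 1 ->
    dotv p (y - e') = - (enorm p * enorm (y - e') ^+ 2 / 2) ->
    F y / J0 - F e' / J0 <= 2 * E.
  move=> y1 e'1 pe.
  rewrite -mulrBl ler_pdivrMr// -mulrA (mulrC E) mulrA JE.
  have -> : F y - F e' = wint s `]eps, +oo[ (fun t => ray y t + - ray e' t).
    by rewrite wintD ?wintN//; exact: bounded_measN.
  apply: (@wint_deviation_le _ _ _ hs1 hs2 _ _ _ _ _ phi_bounded heps0 heps1 C0 _ p (enorm (y - e'))) => //.
  - exact: enorm_ge0.
  - by apply: le_trans (enormD _ _) _; rewrite enormN y1 e'1.
  - by apply: bounded_measD => //; exact: bounded_measN.
  - move=> t t0 te; have := sphere_diff_le hC2 hM M0 y1 e'1 t0 te.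
    rewrite -/p pe /ray; lra.
  - move=> t te; apply: le_trans (ler_norm _) _.
    by apply: (@sphere_chain_le _ _ _ _ _ phi_bounded N1) => //; exact: lt_trans te.
have S1 : S <= F e / J0 + 2 * E.
  by apply: S_le => y y1; have := dev y e y1 e1 (dotv_gradient_sub y1); lra.
have I1 : F (- e) / J0 - 2 * E <= I.
  apply: I_ge => y y1.
  have yN1 : enorm (- y) = 1 by rewrite enormN.
  have h : dotv p (- e - y) = - (enorm p * enorm (- e - y) ^+ 2 / 2).
    by have := dotv_gradient_sub yN1; rewrite [- y - e]addrC.
  by have := dev (- e) y eN1 y1 h; lra.
(* Thus S - F e / J0 lies in [0, 2E] and I - F (- e) / J0 in [-2E, 0], so their sum is at most 2E in
   absolute value, not 4E. *)
have S2 := F_le e1; have I2 := F_ge eN1.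
by rewrite ler_norml; apply/andP; split; lra.
Qed.

End NonzeroGradient.

Lemma main_estimate :
  (`| (Aeps s eps phi x - phi x)%:E
       - ((cs s * (1 - s))^-1 * powR eps (2 * s))%:E * Ls s phi x |
    <= (s / (1 - s) * C * eps ^+ 2 + Eeps s phi x eta p C eps)%:E)%E.
Proof.
have s10 : 0 < 1 - s by rewrite subr_gt0.
have cE : (cs s * (1 - s))^-1 * eps `^ (2 * s) = (2 * m)^-1.
  have -> : eps `^ (2 * s) = (eps `^ (- 2 * s))^-1 by rewrite -powRN mulNr opprK.
  by rewrite /cs /m /J0; field; rewrite !gt_eqF ?powR_gt0.
have rE : r / (2 * m) = s / (1 - s) * C * eps ^+ 2.
  have -> : eps ^+ 2 = eps `^ (2 - 2 * s) / eps `^ (- 2 * s).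
    rewrite -powRB; last by apply/implyP => _; rewrite gt_eqF.
    by rewrite mulNr opprK subrK (@powR_mulrn _ eps 2)// ltW.
  by rewrite /r /m /J0; field; rewrite !gt_eqF ?powR_gt0.
rewrite cE -rE /Aeps -/T -/S -/I.
(* Q stands for the sum of averages that the operator actually sees: S + I if p = 0, the averages
   along e and - e otherwise. After division by 2m, r becomes the C_x eps^2 term, and halving S + I
   - Q gives E_eps. *)
suff [Q [l lE hl] hQ] : exists2 Q, exists2 l : R, Ls s phi x = l%:E & `|l - m * (Q - 2 * phi x)| <= r &
    `|S + I - Q| <= 2 * Eeps s phi x eta p C eps.
  rewrite lE -EFinM -EFinB lee_fin.
  have -> : 2^-1 * (S + I) - phi x - (2 * m)^-1 * l =
      (S + I - Q) / 2 - (l - m * (Q - 2 * phi x)) / (2 * m).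
    by field; rewrite gt_eqF.
  apply: le_trans (ler_normB _ _) _; rewrite addrC lerD//.
    have i0 : 0 < (2 * m)^-1 by rewrite invr_gt0 mulr_gt0.
    by rewrite normrM (gtr0_norm i0) (ler_pM2r i0).
  have i2 : 0 < 2^-1 :> R by rewrite invr_gt0.
  by rewrite normrM (gtr0_norm i2) ler_pdivrMr// mulrC.
have [p0|p0] := eqVneq p 0.
  exists (S + I); first exact: Ls_zero_gradient.
  by rewrite subrr normr0 mulr_ge0//; exact: Eeps_ge0.
eexists; [exact: Ls_nonzero_gradient p0|exact: sup_inf_deviation p0].
Qed.

End Main.

Unset Implicit Arguments. Set Strict Implicit.

Theorem theorem1p1 (R : realType) (N : nat) (s : R)
  (hN : (0 < N)%N) (hs1 : 2^-1 < s) (hs2 : s < 1)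
  (phi : 'rV[R]_N -> R) (x : 'rV[R]_N) (eta : R)
  (G : 'rV[R]_N -> 'rV[R]_N) (Hs : 'rV[R]_N -> 'M[R]_N)
  (heta : 0 < eta) (hH : hypH phi x eta G Hs)
  (eps : R) (heps0 : 0 < eps) (heps1 : eps < eta) :
  (`| (Aeps s eps phi x - phi x)%:E
       - ((cs s * (1 - s))^-1 * powR eps (2 * s))%:E * Ls s phi x |
    <= (s / (1 - s) * Cx x eta Hs * eps ^+ 2
        + Eeps s phi x eta (G x) (Cx x eta Hs) eps)%:E)%E.
Proof.
exact: main_estimate.
Qed.
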